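(* Let $(W,S)$ be a Coxeter system, $u,v\in W$ with $u<v$, and $n=l(u,v)-1$. Then $$P_{u,v}(q)=\sum_{i=0}^{\lfloor n/2\rfloor}a_i\,q^iB_{n-2i}(-q),$$ where $$a_i=a_i(u,v)=[{\bf c}^{n-2i}]_{u,v}+\sum_{{\bf d}w\text{ even}}(-1)^{\frac{|w|}{2}+|w|_{\bf d}}\,C_{{\bf d}w}\,[{\bf c}^{n-2i}{\bf d}w]_{u,v},$$ the sum being over all ${\bf cd}$-words $w$ (including the empty word) such that ${\bf d}w$ is even.
   Context: $(W,S)$ Coxeter system, length $l$, Bruhat order $\le$, $l(u,v)=l(v)-l(u)$. $R$-polynomials $R_{u,v}(q)$: defined by $(T_{v^{-1}})^{-1}=q^{-l(v)}\sum_{u\le v}(-1)^{l(v)-l(u)}R_{u,v}(q)T_u$ in the Hecke algebra (free $\mathbb Z[q^{\pm1}]$-module on $T_w$, $T_wT_s=T_{ws}$ if $l(ws)>l(w)$, else $qT_{ws}+(q-1)T_w$), $R_{u,v}=0$ if $u\not\le v$. $\widetilde R_{u,v}\in\mathbb N[q]$ satisfies $R_{u,v}(q)=q^{l(u,v)/2}\widetilde R_{u,v}(q^{1/2}-q^{-1/2})$. Kazhdan–Lusztig polynomials $P_{u,v}$: unique polynomials with $P_{u,v}=0$ if $u\not\le v$, $P_{u,u}=1$, $\deg P_{u,v}<\frac12l(u,v)$ for $u<v$, $q^{l(u,v)}P_{u,v}(1/q)=\sum_{u\le z\le v}R_{u,z}(q)P_{z,v}(q)$. Quasisymmetric notation: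 $M_\alpha=\sum_{i_1<\cdots<i_k}x_{i_1}^{\alpha_1}\cdots x_{i_k}^{\alpha_k}$, $L_\beta=\sum_{\alpha\text{ refines }\beta}M_\alpha$, $L^{(n)}_T=L_\beta$ for the composition of $n$ with partial-sum set $T\subseteq[n-1]$. ${\bf c},{\bf d}$ noncommuting of degrees 1, 2; $|w|$ the degree of a word, $|w|_{\bf d}$ its number of ${\bf d}$'s. For $w={\bf c}^{p_1}{\bf d}\cdots{\bf c}^{p_r}{\bf d}{\bf c}^{p_0}$ of degree $m$, with $m_j=\deg({\bf c}^{p_1}{\bf d}\cdots{\bf c}^{p_j}{\bf d})$, $\Theta_w=\sum L^{(m+1)}_T$ over $T\subseteq[m]$ such that both $T$ and $[m]\setminus T$ meet every $\{m_j-1,m_j\}$. $\widetilde F(u,v)=\sum\prod_{j=1}^k\widetilde R_{u_{j-1},u_j}(x_j)$ over multichains $u=u_0\le\cdots\le u_{k-1}<u_k=v$; it is uniquely written $\widetilde F(u,v)=\sum_w[w]_{u,v}\Theta_w$ ($[w]_{u,v}$ = coefficients of the complete ${\bf cd}$-index). A word $w={\bf c}^{n_0}{\bf d}{\bf c}^{n_1}{\bf d}\cdots{\bf c}^{n_{k-1}}{\bf d}{\bf c}^{n_k}$ is even if $n_1,\dots,n_k$ are all even; $C_w=\prod_{j=1}^kC_{n_j/2}$ (and $C_{{\bf c}^m}=1$), where $C_i=\frac{1}{2i+1}\binom{2i+1}{i}$ for $i\in\mathbb N$ and $C_i=0$ otherwise. The ballot polynomial is $B_k(q)=\sum_{i=0}^{\lfloor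 k/2\rfloor}\frac{k+1-2i}{k+1}\binom{k+1}{i}q^i$. *)

(* Defs.v *)
From HB Require Import structures.
From Stdlib Require Import Relation_Operators.
From mathcomp Require Import all_boot all_order all_algebra finmap.
From mathcomp Require Import boolp classical_sets cardinality fsbigop.

Set Implicit Arguments.
Unset Strict Implicit.
Unset Printing Implicit Defensive.

Import Order.TTheory GRing.Theory Num.Theory.

Local Open Scope classical_set_scope.
Local Open Scope ring_scope.

(* [W] has the presentation < S | (s t)^(m s t) = 1, m s t finite >, stated by
   its universal property; [m s t = 0] encodes m(s,t) = oo, for which the
   relation [(s * t) ^+ 0 = 1] is vacuous. *)
Definition coxeter_system (W : groupType) (S : set W) : Prop :=
  exists m : W -> W -> nat,
  [/\ forall s, S s -> m s s = 1%N,
      forall s t, S s -> S t -> s <> t -> m s t = m t s /\ m s t <> 1%N,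
      forall s t, S s -> S t -> ((s * t) ^+ m s t = 1)%g,
      forall w : W, exists2 r : seq W,
        (forall s, s \in r -> S s) & w = (\prod_(s <- r) s)%g
    & forall (G : groupType) (f : W -> G),
        (forall s t, S s -> S t -> ((f s * f t) ^+ m s t = 1)%g) ->
        exists phi : W -> G, {morph phi : x y / (x * y)%g} /\
                             forall s, S s -> phi s = f s].

Section Coxeter.
Variables (W : groupType) (S : set W).

Definition expressible (w : W) (k : nat) : Prop :=
  exists r : seq W,
    [/\ size r = k, forall s, s \in r -> S s & w = (\prod_(s <- r) s)%g].

Definition len (w : W) : nat :=
  xget 0%N [set k | expressible w k /\
                    forall j, expressible w j -> (k <= j)%N].

Definition reflection (t : W) : Prop :=
  exists w s : W, S s /\ t = (w * s * w^-1)%g.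

Definition bruhat_step (u v : W) : Prop :=
  exists t : W, [/\ reflection t, v = (u * t)%g & (len u < len v)%N].

Definition bruhat (u v : W) : Prop := clos_refl_trans W bruhat_step u v.

Definition bruhat_lt (u v : W) : Prop := bruhat u v /\ u <> v.

(* Only used for [bruhat u v], where [len u <= len v]. *)
Definition len2 (u v : W) : nat := (len v - len u)%N.

End Coxeter.

(* Z[q, q^-1], as a subring of the field of fractions of Z[q]. *)
Notation ratfun := {fraction {poly int}}.

Definition qf : ratfun := tofrac ('X : {poly int}).

Definition evalf (p : {poly int}) (x : ratfun) : ratfun :=
  (map_poly (intr : int -> ratfun) p).[x].

Definition is_laurent : pred ratfun :=
  fun x => `[< exists (p : {poly int}) (k : nat), x = tofrac p / qf ^+ k >].

Lemma qf_neq0 : qf != 0.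
Proof. by rewrite /qf tofrac_eq0 polyX_eq0. Qed.

Lemma subf_div (F : fieldType) (x1 y1 x2 y2 : F) : y1 != 0 -> y2 != 0 ->
  x1 / y1 - x2 / y2 = (x1 * y2 - x2 * y1) / (y1 * y2).
Proof. by move=> h1 h2; rewrite -mulNr addf_div // mulNr. Qed.

Lemma is_laurent_subring : subring_closed is_laurent.
Proof.
split.
- by apply/asboolP; exists 1, 0%N; rewrite rmorph1 expr0 divr1.
- move=> x y /asboolP [p [j ->]] /asboolP [r [k ->]]; apply/asboolP.
  exists (p * 'X^k - r * 'X^j), (j + k)%N.
  rewrite subf_div ?expf_neq0 ?qf_neq0 // exprD; congr (_ / _).
  by rewrite tofracB !tofracM !tofracXn.
- move=> x y /asboolP [p [j ->]] /asboolP [r [k ->]]; apply/asboolP.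
  by exists (p * r), (j + k)%N; rewrite tofracM exprD mulf_div.
Qed.

HB.instance Definition _ :=
  GRing.isSubringClosed.Build ratfun is_laurent is_laurent_subring.

Record laurent : Type :=
  Laurent { laurent_val : ratfun; _ : laurent_val \in is_laurent }.

HB.instance Definition _ := [isSub for laurent_val].
HB.instance Definition _ := [Choice of laurent by <:].
HB.instance Definition _ := [SubChoice_isSubComNzRing of laurent by <:].

Lemma qf_laurent : qf \in is_laurent.
Proof. by apply/asboolP; exists 'X, 0%N; rewrite expr0 divr1. Qed.

Lemma qfV_laurent : qf^-1 \in is_laurent.
Proof. by apply/asboolP; exists 1, 1%N; rewrite rmorph1 expr1 div1r. Qed.

Definition q : laurent := Laurent qf_laurent.
Definition qV : laurent := Laurent qfV_laurent.

Section Kazhdan_Lusztig.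
Variables (W : groupType) (S : set W).

Record hecke_algebra (H : algType laurent) (T : W -> H) : Prop := {
  hecke_basis : forall h : H, exists! a : {fsfun W -> laurent with 0},
    h = \sum_(w <- finsupp a) a w *: T w;
  hecke_one : T 1%g = 1;
  hecke_mul_lt : forall w s : W, S s -> (len S w < len S (w * s)%g)%N ->
    T w * T s = T (w * s)%g;
  hecke_mul_gt : forall w s : W, S s -> ~~ (len S w < len S (w * s)%g)%N ->
    T w * T s = q *: T (w * s)%g + (q - 1) *: T w }.

(* Lower Bruhat intervals are finite, so the sums over them below, which
   would be 0 by convention on an infinite support, are genuine. *)
Record R_polynomials (H : algType laurent) (T : W -> H)
    (R : W -> W -> {poly int}) : Prop := {
  R_inverse : forall v : W,
    let X := qV ^+ len S v *:
      \sum_(u \in [set u | bruhat S u v])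
        ((-1) ^+ len2 S u v *
           (map_poly (intr : int -> laurent) (R u v)).[q]) *: T u in
    X * T (v^-1)%g = 1 /\ T (v^-1)%g * X = 1;
  R_support : forall u v : W, ~ bruhat S u v -> R u v = 0 }.

(* The indeterminate of [ratfun] plays here the role of q^(1/2), so that
   R(q) becomes R composed with 'X^2. *)
Record Rtilde_polynomials (R Rt : W -> W -> {poly int}) : Prop := {
  Rtilde_ge0 : forall (u v : W) (i : nat), 0 <= (Rt u v)`_i;
  Rtilde_eq : forall u v : W, bruhat S u v ->
    evalf (R u v) (qf ^+ 2) = qf ^+ len2 S u v * evalf (Rt u v) (qf - qf^-1);
  Rtilde_support : forall u v : W, ~ bruhat S u v -> Rt u v = 0 }.

(* Degree bound: deg P < l(u,v)/2, where [size p] is 1 + deg p. *)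
Record KL_polynomials (R P : W -> W -> {poly int}) : Prop := {
  KL_support : forall u v : W, ~ bruhat S u v -> P u v = 0;
  KL_diag : forall u : W, P u u = 1;
  KL_deg : forall u v : W, bruhat_lt S u v ->
    ((size (P u v)).-1.*2 < len2 S u v)%N;
  KL_eq : forall u v : W, bruhat S u v ->
    qf ^+ len2 S u v * evalf (P u v) qf^-1 =
    \sum_(z \in [set z | bruhat S u z /\ bruhat S z v])
      evalf (R u z) qf * evalf (P z v) qf }.

End Kazhdan_Lusztig.

(* A formal power series in infinitely many variables, as the function sending
   each exponent vector to a coefficient; the variable x_j, j >= 1, is given
   the index j - 1. *)
Definition monom := {fsfun nat -> nat with 0%N}.
Definition series := monom -> int.

(* The monomial x_{i_1}^{al_1} ... x_{i_k}^{al_k} has exponent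
   [nth 0 al (index j i)] at j, which is 0 if j does not occur in i. *)
Definition monomial_qsym (al : seq nat) : series := fun e =>
  (`[< exists i : seq nat, [/\ sorted ltn i, size i = size al
        & forall j, e j = nth 0%N al (index j i)] >])%:R.

Definition composition (al : seq nat) : bool := all (fun a => 0 < a)%N al.

Definition refines (al be : seq nat) : Prop :=
  exists bs : seq (seq nat), flatten bs = al /\ map sumn bs = be.

Definition fundamental_qsym (be : seq nat) : series := fun e =>
  \sum_(al \in [set al | composition al /\ refines al be]) monomial_qsym al e.

Definition interval1 (m : nat) : {set 'I_m.+1} := [set i : 'I_m.+1 | (0 < i)%N]%SET.

(* The composition of m.+1 with set of proper partial sums T, T in [m];
   [enum] lists T in increasing order. *)
Definition comp_of_set (m : nat) (T : {set 'I_m.+1}) : seq nat :=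
  pairmap (fun a b => b - a)%N 0%N
          (rcons [seq nat_of_ord i | i <- enum T] m.+1).

Inductive cdletter := Lc | Ld.

Definition bool_of_letter (x : cdletter) : bool := if x is Ld then true else false.
Definition letter_of_bool (b : bool) : cdletter := if b then Ld else Lc.
Lemma bool_of_letterK : cancel bool_of_letter letter_of_bool.
Proof. by case. Qed.
HB.instance Definition _ := Countable.copy cdletter (can_type bool_of_letterK).

Definition cdword := seq cdletter.

Definition letter_deg (x : cdletter) : nat := if x is Ld then 2%N else 1%N.
Definition wdeg (w : cdword) : nat := sumn (map letter_deg w).
Definition wnum_d (w : cdword) : nat := count_mem Ld w.

(* The degrees m_1 < ... < m_r of the prefixes of w ending in d. *)
Definition dpos (w : cdword) : seq nat :=
  [seq wdeg (take i.+1 w) | i <- iota 0 (size w) & nth Lc w i == Ld].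

Definition meets_dblocks (w : cdword) (m : nat) (T : {set 'I_m.+1}) : bool :=
  all (fun mj => [exists i in T, (val i == mj.-1) || (val i == mj)]) (dpos w).

Definition Theta (w : cdword) : series := fun e =>
  let m := wdeg w in
  \sum_(T : {set 'I_m.+1} | [&& T \subset interval1 m, meets_dblocks w T
                              & meets_dblocks w (interval1 m :\: T)%SET])
    fundamental_qsym (comp_of_set T) e.

(* The series p_1(x_1) ... p_k(x_k), for ps = [:: p_1; ...; p_k]. *)
Definition separated_prod (ps : seq {poly int}) : series := fun e =>
  if all (fun j => j < size ps)%N (finsupp e)
  then \prod_(j < size ps) (nth 0 ps j)`_(e j) else 0.

Section Complete_cd_index.
Variables (W : groupType) (S : set W) (Rt : W -> W -> {poly int}).

(* c = [:: u_0; ...; u_(k+1)] with u_k < u_(k+1) = v. *)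
Definition multichain (u v : W) (c : seq W) : Prop :=
  exists k : nat, [/\ size c = k.+2, nth u c 0 = u, nth u c k.+1 = v,
    forall j, (j <= k)%N -> bruhat S (nth u c j) (nth u c j.+1)
    & nth u c k <> v].

Definition chain_weight (u : W) (c : seq W) : series :=
  separated_prod (pairmap Rt (head u c) (behead c)).

(* For every exponent e, only finitely many multichains contribute, because
   the last polynomial in the product has no constant term. *)
Definition Ftilde (u v : W) : series := fun e =>
  \sum_(c \in [set c | multichain u v c]) chain_weight u c e.

(* [psi w] is the coefficient [w]_{u,v}. *)
Definition complete_cd_index (u v : W)
    (psi : {fsfun cdword -> int with 0}) : Prop :=
  forall e : monom, Ftilde u v e = \sum_(w <- finsupp psi) psi w * Theta w e.

End Complete_cd_index.

(* The exponents [:: n_0; ...; n_k] of w = c^{n_0} d c^{n_1} ... d c^{n_k}. *)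
Fixpoint cexponents (w : cdword) : seq nat :=
  match w with
  | [::] => [:: 0%N]
  | Lc :: w' => (head 0%N (cexponents w')).+1 :: behead (cexponents w')
  | Ld :: w' => 0%N :: cexponents w'
  end.

Definition even_word (w : cdword) : bool :=
  all (fun n => ~~ odd n) (behead (cexponents w)).

Definition catalan (i : nat) : rat := ('C(i.*2.+1, i))%:R / (i.*2.+1)%:R.

Definition catalan_half (n : nat) : rat := if odd n then 0 else catalan n./2.

Definition Cword (w : cdword) : rat :=
  \prod_(n <- behead (cexponents w)) catalan_half n.

Definition ballot (k : nat) : {poly rat} :=
  \poly_(i < k./2.+1) ((k.+1 - i.*2)%:R / k.+1%:R * ('C(k.+1, i))%:R).

(* a_i, for r = n - 2i. *)
Definition acoef (psi : {fsfun cdword -> int with 0}) (r : nat) : rat :=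
  (psi (nseq r Lc))%:~R +
  \sum_(w \in [set w : cdword | even_word (Ld :: w)])
    (-1) ^+ ((wdeg w)./2 + wnum_d w) * Cword (Ld :: w) *
    (psi (nseq r Lc ++ Ld :: w))%:~R.

(* Main.v *)
(* Put x = q^(1/2), y = x - 1/x and p_{u,v} = x^(-l(u,v)) P_{u,v}(x^2), which for
   u < v has only negative powers of x.  Write neg f for the part of f with negative
   powers.  The identity defining P_{u,v} gives
     p_{u,v} = - neg (sum_{u < z <= v} Rtilde_{u,z}(y) p_{z,v}),
   and iterating along chains shows that p_{u,v} is the image of Ftilde(u,v) under
   the linear functional sending M_(a_1, ..., a_k) to
     - neg y^(a_1) (- neg y^(a_2) (... (- neg y^(a_k)))).
   On a fundamental quasisymmetric function L_T one thus applies, between successive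
   factors y, - neg at the positions in T and 1 - neg elsewhere; hence on Theta_w a
   letter c becomes the operator f |-> y (f - 2 neg f), and a letter d becomes
   f |-> y (- neg y f - y neg f + 2 neg y neg f).  Everything stays antisymmetric
   under x <-> 1/x, and on an antisymmetric f the latter is f |-> f_1 y, where f_1 is
   the coefficient of f at x.  So a word factors at its d's: c^r yields the ballot
   polynomials, and their coefficients at x the signed Catalan numbers.
   Triangularity of the ballot polynomials finally shows that words of degree
   greater than l(u,v) - 1 contribute nothing. *)

From HB Require Import structures.
From Stdlib Require Import Relation_Operators Operators_Properties.
Require Import Defs.
From mathcomp Require Import all_boot all_order all_algebra finmap.
From mathcomp Require Import boolp classical_sets functions cardinality fsbigop.
From mathcomp Require Import zify ring.

Set Implicit Arguments.
Unset Strict Implicit.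
Unset Printing Implicit Defensive.

Import Order.TTheory GRing.Theory Num.Theory.

Local Open Scope classical_set_scope.
Local Open Scope ring_scope.

(** * Finiteness of lower Bruhat intervals *)

Section TwistedProduct.
Local Open Scope group_scope.
Variable W : groupType.

(* P(W) x| W, with [W] acting by conjugation on its subsets, which are given by
   their indicator functions and added by symmetric difference. *)
Definition subset_semidirect : Type := ((W -> bool) * W)%type.
HB.instance Definition _ := Choice.on subset_semidirect.
Local Notation G := subset_semidirect.

Definition rc_mul (a b : G) : G :=
  (fun x => a.1 x (+) b.1 (a.2^-1 * x * a.2), a.2 * b.2).
Definition rc_one : G := (fun=> false, 1).
Definition rc_inv (a : G) : G := (fun x => a.1 (a.2 * x * a.2^-1), a.2^-1).

Lemma rc_mulA : associative rc_mul.
Proof.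
move=> a b c; congr (_, _); last by rewrite /= mulgA.
by apply/funext => x /=; rewrite addbA invgM !mulgA.
Qed.

Lemma rc_mul1 : left_id rc_one rc_mul.
Proof.
case=> A a; congr (_, _); last by rewrite /= mul1g.
by apply/funext => x /=; rewrite invg1 mul1g mulg1.
Qed.

Lemma rc_mulr1 : right_id rc_one rc_mul.
Proof.
case=> A a; congr (_, _); last by rewrite /= mulg1.
by apply/funext => x /=; rewrite addbF.
Qed.

Lemma rc_mulV : left_inverse rc_one rc_inv rc_mul.
Proof.
case=> A a; congr (_, _); last by rewrite /= mulVg.
by apply/funext => x /=; rewrite invgK addbb.
Qed.

Lemma rc_mulrV : right_inverse rc_one rc_inv rc_mul.
Proof.
case=> A a; congr (_, _); last by rewrite /= mulgV.
by apply/funext => x /=; rewrite !mulgA mulgV mul1g -mulgA mulgV mulg1 addbb.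
Qed.

HB.instance Definition _ :=
  isGroup.Build G rc_mulA rc_mul1 rc_mulr1 rc_mulV rc_mulrV.

Definition rc_gen (s : W) : G := (fun x => x == s, s).

(** Conjugation by [s * t] carries the reflection [(s * t) ^+ j * s] to [(s * t) ^+ j.+2 * s], so a
    further factor shifts the reflections already listed by two places and adds [s] and [s * t * s]
    in front. *)
Lemma rc_expE (s t : W) (k : nat) : s * s = 1 -> t * t = 1 ->
  (rc_gen s * rc_gen t) ^+ k =
  (fun x => \big[addb/false]_(i < k.*2) (x == (s * t) ^+ i * s), (s * t) ^+ k)
  :> G.
Proof.
move=> ss tt.
have sV : s^-1 = s by rewrite -[LHS]mulg1 -ss mulKg.
have tV : t^-1 = t by rewrite -[LHS]mulg1 -tt mulKg.
have conj x j : (x == (s * t) ^+ j.+2 * s) =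
    ((s * t)^-1 * x * (s * t) == (s * t) ^+ j * s).
  have -> : (s * t) ^+ j.+2 * s = (s * t) * ((s * t) ^+ j * s) * (s * t)^-1.
    by rewrite expgSr expgS invgM sV tV !mulgA.
  move: (s * t) (_ * s) => a y.
  apply/eqP/eqP => [->|<-]; rewrite !mulgA.
    by rewrite mulVg mul1g mulgVK.
  by rewrite mulgV mul1g mulgK.
elim: k => [|k IH].
  by congr (_, _); apply/funext => x; rewrite big_ord0.
rewrite expgS {}IH; congr (_, _); last by rewrite /= -expgS.
apply/funext => x; rewrite doubleS 2!big_ord_recl /= addbA.
congr (_ (+) _); last by apply: eq_bigr => i _; rewrite conj.
rewrite expg0 expg1 mul1g; congr (_ (+) _).
apply/eqP/eqP => [<-|->]; rewrite !mulgA.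
  by rewrite sV ss mul1g -mulgA ss mulg1.
by rewrite sV ss mul1g -mulgA ss mulg1.
Qed.
End TwistedProduct.

(** * Inversions, exchange and lower Bruhat intervals *)

Section Coxeter.
Variables (W : groupType) (S : set W).
Hypothesis coxS : coxeter_system S.

Lemma coxeter_invol (s : W) : S s -> (s * s = 1)%g.
Proof. by case: coxS => m [ms _ mr _ _] Ss; rewrite -(mr s s Ss Ss) ms. Qed.

Lemma coxeter_expr (w : W) :
  exists2 r : seq W, (forall s, s \in r -> S s) & w = (\prod_(s <- r) s)%g.
Proof. by case: coxS => m [_ _ _ /(_ w)]. Qed.

Lemma coxeter_ind (P : W -> Prop) : P 1%g ->
  (forall s w, S s -> P w -> P (s * w)%g) -> forall w, P w.
Proof.
move=> P1 PM w; have [r rS ->] := coxeter_expr w; elim: r rS => [|s r IH] rS.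
  by rewrite big_nil.
rewrite big_cons; apply: PM; first by apply: rS; rewrite mem_head.
by apply: IH => t tr; apply: rS; rewrite inE tr orbT.
Qed.

Lemma len_spec (w : W) :
  expressible S w (len S w) /\ forall j, expressible S w j -> (len S w <= j)%N.
Proof.
rewrite /len; case: xgetP => [k _ //|]; have [r rS wr] := coxeter_expr w.
have ex : exists k, `[< expressible S w k >].
  by exists (size r); apply/asboolP; exists r.
case: (ex_minnP ex) => k /asboolP hk kmin /(_ k) []; split=> // j hj.
by apply: kmin; apply/asboolP.
Qed.

(* The left inversion set of [w], as a parity; the universal property is used
   only to see that this parity does not depend on an expression of [w]. *)
Lemma inversion_cocycle : exists N : W -> W -> bool,
  [/\ forall x, N 1%g x = false,
      forall s w x, S s -> N (s * w)%g x = (x == s) (+) N w (s * x * s)%g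
    & forall v w x, N (v * w)%g x = N v x (+) N w (v^-1 * x * v)%g].
Proof.
case: coxS => m [ms msym mr _ /(_ (subset_semidirect W) (@rc_gen W))] [].
  move=> s t Ss St; rewrite rc_expE ?coxeter_invol //; congr (_, _); last first.
    by rewrite mr.
  apply/funext => x; rewrite -addnn big_split_ord /=.
  set A := \big[_/_]_(_ < _) _; set B := \big[_/_]_(_ < _) _.
  (* Since [(s * t) ^+ m s t = 1], the reflections of index [i] and [m s t + i] coincide, so the two
     halves cancel and the Coxeter relation holds in the semidirect product. *)
  suff -> : A = B by rewrite addbb.
  by apply: eq_bigr => i _; rewrite /= expgnDr mr // mul1g.
move=> phi [phiM phiS].
have phi2M v w : (phi (v * w)%g).2 = ((phi v).2 * (phi w).2)%g by rewrite phiM.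
have phi1 : phi 1%g = 1%g by apply: (mulgI (phi 1%g)); rewrite -phiM !mulg1.
have phi2 : forall w, (phi w).2 = w.
  apply: coxeter_ind => [|s w Ss IH]; first by rewrite phi1.
  by rewrite phi2M IH phiS.
exists (fun w => (phi w).1); split=> [x|s w x Ss|v w x]; first by rewrite phi1.
  rewrite phiM phiS //=; congr (_ (+) (phi w).1 (_ * _ * _)%g).
  by rewrite -[LHS]mulg1 -(coxeter_invol Ss) mulKg.
by rewrite phiM /= phi2.
Qed.

(** The strong exchange property. If [x] has odd parity, then at some letter [s] of [r] the
    successively conjugated [x] equals [s]; left multiplication by [x] deletes that letter. *)
Lemma len_reflection_mul (N : W -> W -> bool) (x : W) (r : seq W) :
  (forall x, N 1%g x = false) ->
  (forall s w x, S s -> N (s * w)%g x = (x == s) (+) N w (s * x * s)%g) ->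
  (forall s, s \in r -> S s) -> N (\prod_(s <- r) s)%g x ->
  exists2 r', (forall s, s \in r' -> S s) & size r = (size r').+1 /\
    (x * \prod_(s <- r) s = \prod_(s <- r') s)%g.
Proof.
move=> N1 NS; elim: r x => [|s r IH] x rS; first by rewrite big_nil N1.
have Ss : S s by apply: rS; rewrite mem_head.
have rS' t : t \in r -> S t by move=> tr; apply: rS; rewrite inE tr orbT.
rewrite big_cons NS //; case: eqP => [-> _|_ /= /IH [] // r' r'S [sz e]].
  by exists r; rewrite // mulgA coxeter_invol // mul1g.
exists (s :: r').
  by move=> t; rewrite inE => /orP [/eqP ->|/r'S].
split; first by rewrite /= sz.
by rewrite big_cons -e !mulgA coxeter_invol // mul1g.
Qed.

(** Each generator in an expression of [v] adds one reflection to [N v], so [N v] is finite; it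
    remains to see that every reflection shortening [v] lies in [N v]. *)
Lemma finite_left_inversions (v : W) :
  finite_set [set x | reflection S x /\ (len S (x * v)%g < len S v)%N].
Proof.
have [N [N1 NS NM]] := inversion_cocycle.
have Nlt x w : N w x -> (len S (x * w)%g < len S w)%N.
  move=> Nx; have [[r [szr rS wr]] _] := len_spec w.
  rewrite wr in Nx; have [r' r'S [sz e]] := len_reflection_mul N1 NS rS Nx.
  rewrite -wr in e; rewrite -[X in (_ < X)%N]szr sz ltnS.
  by have [_ ->] // := len_spec (x * w)%g; exists r'.
have NV w x : N w^-1%g x = N w (w * x * w^-1)%g.
  have := NM w w^-1%g (w * x * w^-1)%g; rewrite mulgV N1 !mulgA mulVg mul1g.
  by rewrite mulgVK; case: (N w^-1%g x); case: (N w _).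
have Nrefl x : reflection S x -> N x x /\ (x * x = 1)%g.
  case=> w [s [Ss ->]]; split; last first.
    by rewrite !mulgA mulgVK -(mulgA w) coxeter_invol // mulg1 mulgV.
  (* For [x = w s w^-1] the contributions of [w] and [w^-1] are equal and cancel, leaving that of
     [s] at itself. *)
  rewrite -mulgA NM !mulgA mulVg mul1g mulgVK NS // eqxx coxeter_invol // mul1g.
  by rewrite NV -!mulgA; case: (N w _).
have fin : finite_set [set x | N v x].
  elim/coxeter_ind: v => [|s w Ss IH].
    by rewrite (_ : [set _ | _] = set0) // -subset0 => x /=; rewrite N1.
  apply: (@sub_finite_set _ _ ([set s] `|` (fun x => s * x * s)%g @` [set x | N w x])).
    move=> x /=; rewrite NS //; case: eqP => [->|_ /= Nx]; [by left|right].
    exists (s * x * s)%g => //=.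
    by rewrite !mulgA coxeter_invol // mul1g -mulgA coxeter_invol // mulg1.
  by rewrite finite_setU; split; [exact: finite_set1|exact: finite_image].
apply: sub_finite_set fin => x [/= /Nrefl [Nx xx] lt].
(* If [N v x] failed, the cocycle rule would give [N (x * v) x], so [x * (x * v) = v] would be
   shorter than [x * v]. *)
apply: contraTT isT => Nvx; suff /Nlt : N (x * v)%g x.
  by rewrite mulgA xx mul1g ltnNge ltnW.
by rewrite NM Nx /= mulVg mul1g (negbTE Nvx).
Qed.

Lemma bruhat_len (u v : W) : bruhat S u v -> (len S u <= len S v)%N.
Proof.
elim=> [x y [t [_ _ /ltnW]] //|//|x y z _ h _]; exact: leq_trans.
Qed.

Lemma bruhat_len_eq (u v : W) : bruhat S u v -> len S u = len S v -> u = v.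
Proof.
elim=> [x y [t [_ _]] /[swap] ->|//|x y z hxy IH hyz IH' e]; first by rewrite ltnn.
have := bruhat_len hxy; have := bruhat_len hyz => h1 h2.
have e1 : len S x = len S y by apply/eqP; rewrite eqn_leq h2 e h1.
by rewrite IH // IH' // -e1.
Qed.

Lemma bruhat_refl u : bruhat S u u. Proof. exact: rt_refl. Qed.

(** Induction on the length. The last step from [y] to [z = y * t] of a chain is undone by left
    multiplication with the reflection [y * t * y^-1], a left inversion of [z], and there are
    finitely many of these. *)
Lemma finite_bruhat_lower (v : W) : finite_set [set u | bruhat S u v].
Proof.
elim/ltn_ind: {v}(len S v) {-2}v (leqnn (len S v)) => k IH v lev.
pose I v := [set x | reflection S x /\ (len S (x * v)%g < len S v)%N].
apply: (@sub_finite_set _ _ ([set v] `|`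
  \bigcup_(x in I v) [set u | bruhat S u (x * v)%g])).
  move=> u /= uv; have uv' := clos_rt_rtn1 _ _ _ _ uv.
  case: uv' lev => [_|y z [t [tr e lt]] uy _]; first by left.
  right; have [w [s [Ss ew]]] := tr.
  have yz : (y * t * y^-1 * z = y)%g.
    rewrite e !mulgA mulgVK -mulgA.
    suff -> : (t * t = 1)%g by rewrite mulg1.
    by rewrite ew !mulgA mulgVK -(mulgA w) coxeter_invol // mulg1 mulgV.
  exists (y * t * y^-1)%g; last by rewrite /= yz; exact: clos_rtn1_rt uy.
  split; last by rewrite yz.
  by exists (y * w)%g, s; rewrite ew invgM !mulgA.
rewrite finite_setU; split; first exact: finite_set1.
apply: bigcup_finite; first exact: finite_left_inversions.
move=> x [_ lt]; apply: (IH (len S (x * v)%g)) => //.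
exact: leq_trans lt lev.
Qed.

End Coxeter.

(** * Truncated Kazhdan-Lusztig recursion *)

(* [f : coefs] stands for the Laurent series with coefficient [f k] at x^k,
   where x = q^(1/2). *)
Definition coefs : Type := int -> int.
HB.instance Definition _ := GRing.Zmodule.copy coefs (int -> int).

Lemma coefsP (f g : coefs) : (forall k, f k = g k) -> f = g.
Proof. by move=> fg; apply/funext. Qed.

Lemma coefsD (f g : coefs) k : (f + g) k = f k + g k. Proof. by []. Qed.
Lemma coefsN (f : coefs) k : (- f) k = - f k. Proof. by []. Qed.
Lemma coefsB (f g : coefs) k : (f - g) k = f k - g k. Proof. by []. Qed.

Lemma coefsMz (f : coefs) (z : int) (k : int) : (f *~ z) k = f k * z.
Proof.
have E n : (f *+ n) k = f k *+ n.
  by elim: n => [|n IH]; rewrite ?mulr0n // !mulrS -IH.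
rewrite -mulrzz; case: z => n; first by rewrite -!pmulrn E.
by rewrite NegzE !mulrNz -!pmulrn -E.
Qed.

Lemma coefs_sum (I : Type) (r : seq I) (P : pred I) (F : I -> coefs) (k : int) :
  (\sum_(i <- r | P i) F i) k = \sum_(i <- r | P i) F i k.
Proof. by apply: (big_morph (fun f : coefs => f k)). Qed.

(* Multiplication by x - x^-1. *)
Definition mulxV (f : coefs) : coefs := fun k => f (k - 1) - f (k + 1).

Lemma mulxV_is_zmod_morphism : zmod_morphism mulxV.
Proof.
by move=> f g; apply: coefsP => k; rewrite /mulxV !coefsB /mulxV; ring.
Qed.

HB.instance Definition _ :=
  GRing.isZmodMorphism.Build coefs coefs mulxV mulxV_is_zmod_morphism.

Definition mulxVX (j : nat) (f : coefs) : coefs := iter j mulxV f.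

Lemma mulxVX_is_zmod_morphism j : zmod_morphism (mulxVX j).
Proof.
by move=> f g; elim: j => //= j IH; rewrite /mulxVX /= -!/(mulxVX _ _) IH raddfB.
Qed.

HB.instance Definition _ j :=
  GRing.isZmodMorphism.Build coefs coefs (mulxVX j) (mulxVX_is_zmod_morphism j).

Lemma mulxVXS j f : mulxVX j.+1 f = mulxV (mulxVX j f). Proof. by []. Qed.

Definition negpart (f : coefs) : coefs := fun k => if k < 0 then f k else 0.

Lemma negpart_is_zmod_morphism : zmod_morphism negpart.
Proof.
move=> f g; apply: coefsP => k; rewrite coefsB /negpart.
by case: ifP; rewrite ?subr0.
Qed.

HB.instance Definition _ :=
  GRing.isZmodMorphism.Build coefs coefs negpart negpart_is_zmod_morphism.

Definition delta0 : coefs := fun k => (k == 0)%:R.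

(* The coefficients of x^-d Q(x). *)
Definition laur (d : nat) (Q : {poly int}) : coefs :=
  fun k => if 0 <= k + d%:Z then Q`_(absz (k + d%:Z)) else 0.

Lemma laur_is_zmod_morphism d : zmod_morphism (laur d).
Proof.
move=> f g; apply: coefsP => k; rewrite coefsB /laur.
by case: ifP; rewrite ?coefB ?subr0.
Qed.

HB.instance Definition _ d :=
  GRing.isZmodMorphism.Build {poly int} coefs (laur d) (laur_is_zmod_morphism d).

Lemma laurS d Q k : laur d.+1 Q k = laur d Q (k + 1).
Proof. by rewrite /laur (_ : k + d.+1%:Z = k + 1 + d%:Z) //; lia. Qed.

Lemma laurX d Q : laur d.+1 ('X * Q) = laur d Q.
Proof.
apply: coefsP => k; rewrite /laur (_ : k + d.+1%:Z = k + d%:Z + 1); last by lia.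
move: (k + d%:Z) => [] m.
  by rewrite (_ : m%:Z + 1 = m.+1%:Z) ?coefXM //=; lia.
rewrite [X in if X then _ else _](_ : _ = (m == 0)%N); last by lia.
by case: m => //=; rewrite coefXM.
Qed.

Lemma laurXn d j Q : laur (j + d) ('X^j * Q) = laur d Q.
Proof. by elim: j => [|j IH]; rewrite ?mul1r // exprS -mulrA addSn laurX. Qed.

Lemma laur_mulxV d Q : laur d.+1 (('X^2 - 1) * Q) = mulxV (laur d Q).
Proof.
rewrite mulrBl mul1r raddfB /= expr2 -mulrA laurX.
apply: coefsP => k; rewrite ?coefsB /mulxV ?coefsB laurS; congr (_ - _).
by rewrite -{1}(subrK 1 k) -laurS laurX.
Qed.

Lemma laur_mulxVX d j Q :
  laur (j + d) (('X^2 - 1) ^+ j * Q) = mulxVX j (laur d Q).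
Proof.
by elim: j => [|j IH]; rewrite ?mul1r // exprS -mulrA addSn laur_mulxV IH.
Qed.

(** * Polynomial forms of the identities in the fraction field *)

Local Notation "x %:F" := (tofrac x).

Lemma tofracZ (c : int) (r : {poly int}) :
  (c *: r)%:F = c%:~R * r%:F :> ratfun.
Proof. by rewrite -{1}(intz c) scaler_int raddfMz mulrzl. Qed.

Lemma evalf_wide (m : nat) (p : {poly int}) (x : ratfun) : (size p <= m)%N ->
  evalf p x = \sum_(j < m) (p`_j)%:~R * x ^+ j.
Proof.
move=> sz; rewrite /evalf (@horner_coef_wide _ m); last first.
  by rewrite (leq_trans (size_poly _ _)).
by apply: eq_bigr => j _; rewrite coef_map.
Qed.

Lemma evalf_tofrac (p r : {poly int}) : evalf p r%:F = (p \Po r)%:F.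
Proof.
rewrite (@evalf_wide (size p)) // comp_polyE rmorph_sum /=.
by apply: eq_bigr => j _; rewrite tofracZ tofracXn.
Qed.

Lemma evalf_qf2 (p : {poly int}) : evalf p (qf ^+ 2) = (p \Po 'X^2)%:F.
Proof. by rewrite -evalf_tofrac tofracXn. Qed.

(* x^l p(x - x^-1), when [size p <= l.+1]. *)
Definition twist (l : nat) (p : {poly int}) : {poly int} :=
  \sum_(j < l.+1) p`_j *: (('X^2 - 1) ^+ j * 'X^(l - j)).

Lemma twistE (l : nat) (p : {poly int}) : (size p <= l.+1)%N ->
  (twist l p)%:F = qf ^+ l * evalf p (qf - qf^-1).
Proof.
move=> sz; rewrite (evalf_wide _ sz) mulr_sumr rmorph_sum /=.
apply: eq_bigr => j _; rewrite tofracZ mulrCA; congr (_ * _).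
rewrite tofracM !tofracXn tofracB tofracXn tofrac1 -/qf.
have -> : qf ^+ 2 - 1 = (qf - qf^-1) * qf.
  by rewrite mulrBl mulVf ?qf_neq0 // expr2.
rewrite exprMn -mulrA -exprD subnKC 1?mulrC //; exact: (ltn_ord j).
Qed.

(* x^l p(x^-1), when [size p <= l.+1]. *)
Definition rev_poly (l : nat) (p : {poly int}) : {poly int} :=
  \sum_(j < l.+1) p`_j *: 'X^(l - j).

Lemma rev_polyE (l : nat) (p : {poly int}) : (size p <= l.+1)%N ->
  (rev_poly l p)%:F = qf ^+ l * evalf p qf^-1.
Proof.
move=> sz; rewrite (evalf_wide _ sz) mulr_sumr rmorph_sum /=.
apply: eq_bigr => j _; rewrite tofracZ mulrCA; congr (_ * _).
rewrite tofracXn -/qf -[X in _ ^+ X * _](@subnK j l); last exact: (ltn_ord j).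
by rewrite exprD -mulrA -exprMn divff ?qf_neq0 // expr1n mulr1.
Qed.

Lemma horner_rev_poly (l : nat) (p : {poly int}) : (size p <= l.+1)%N ->
  (rev_poly l p).[1] = p.[1].
Proof.
move=> sz; rewrite (horner_coef_wide _ sz) horner_sum.
by apply: eq_bigr => j _; rewrite !hornerE !expr1n.
Qed.

(** * R-polynomials and Kazhdan-Lusztig polynomials as Laurent coefficients *)

Section KLcoefficients.
Variables (W : groupType) (S : set W) (H : algType laurent) (T : W -> H).
Variables (R Rt P : W -> W -> {poly int}).
Hypothesis coxS : coxeter_system S.
Hypothesis hR : R_polynomials S T R.
Hypothesis hRt : Rtilde_polynomials S R Rt.
Hypothesis hP : KL_polynomials S R P.

(** If the degree [N] of [Rt u v] exceeded [l = l(u,v)], then [x^N Rt(x - x^-1)] would have constant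
    term plus or minus the leading coefficient of [Rt u v]; but it equals [x^(N-l) R(x^2)], which
    vanishes at 0. *)
Lemma size_Rtilde u v : (size (Rt u v) <= (len2 S u v).+1)%N.
Proof.
have [uv|nuv] := pselect (bruhat S u v); last first.
  by rewrite (Rtilde_support hRt nuv) size_poly0.
rewrite leqNgt; apply/negP => lt; set l := len2 S u v in lt *.
pose N := (size (Rt u v)).-1; have lN : (l < N)%N by rewrite /N; lia.
have szN : (size (Rt u v) <= N.+1)%N by rewrite leqSpred.
have : (twist N (Rt u v))%:F = ('X^(N - l) * (R u v \Po 'X^2))%:F :> ratfun.
  rewrite twistE // -(@subnK l N (ltnW lN)) exprD -mulrA -(Rtilde_eq hRt) // addnK.
  by rewrite evalf_qf2 tofracM tofracXn.
move/eqP; rewrite tofrac_eq => /eqP /(congr1 (fun p => p.[0])).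
rewrite hornerM hornerXn expr0n subn_eq0 leqNgt lN mul0r /twist horner_sum.
rewrite big_ord_recr big1 /= => [|j _]; last first.
  by rewrite hornerZ hornerM hornerXn expr0n subn_eq0 leqNgt ltn_ord !mulr0.
rewrite add0r subnn hornerZ hornerM horner_exp hornerD hornerN hornerXn hornerC.
rewrite expr0n sub0r mulr1 => /eqP.
rewrite mulf_eq0 expf_eq0 oppr_eq0 oner_eq0 andbF orbF lead_coef_eq0.
by move=> /eqP e; move: lN; rewrite /N e size_poly0.
Qed.

Lemma Rtilde_neq0 u v j : (Rt u v)`_j != 0 ->
  bruhat S u v /\ (j <= len2 S u v)%N.
Proof.
move=> nz; split.
  have [//|nb] := pselect (bruhat S u v).
  by rewrite (Rtilde_support hRt nb) coef0 eqxx in nz.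
rewrite leqNgt; apply: contraNN nz => lj; rewrite nth_default //.
exact: leq_trans (size_Rtilde _ _) lj.
Qed.

Lemma R_twist u v : bruhat S u v ->
  R u v \Po 'X^2 = twist (len2 S u v) (Rt u v).
Proof.
move=> uv; apply/eqP; rewrite -tofrac_eq twistE ?size_Rtilde //.
by rewrite -(Rtilde_eq hRt) // evalf_qf2.
Qed.

Lemma len2_bruhatD u z v : bruhat S u z -> bruhat S z v ->
  len2 S u v = (len2 S u z + len2 S z v)%N.
Proof. by move=> /bruhat_len h1 /bruhat_len h2; rewrite /len2; lia. Qed.

Lemma size_KL u v : (size (P u v) <= (len2 S u v).+1)%N.
Proof.
have [uv|nuv] := pselect (bruhat S u v); last first.
  by rewrite (KL_support hP nuv) size_poly0.
have [->|ne] := eqVneq u v; first by rewrite (KL_diag hP) size_poly1.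
by have := KL_deg hP (conj uv (elimN eqP ne)); lia.
Qed.

Lemma KL_poly u v (I : seq W) : uniq I -> (forall z, z \in I <-> bruhat S z v) ->
  bruhat S u v ->
  rev_poly (len2 S u v) (P u v) = \sum_(z <- I) R u z * P z v.
Proof.
move=> uI memI uv; apply/eqP; rewrite -tofrac_eq rev_polyE ?size_KL //.
rewrite (KL_eq hP uv) (fsbig_fwiden I) // => [|z [_] /memI //|z]; last first.
  case=> /= /memI zv nz; rewrite (R_support hR) => [|uz]; last exact: nz.
  by rewrite /evalf rmorph0 horner0 mul0r.
rewrite rmorph_sum /=; apply/eqP; apply: eq_bigr => z _.
by rewrite tofracM /qf !evalf_tofrac !comp_polyXr.
Qed.

Definition bruhat_lower (v : W) : seq W := fset_set [set u | bruhat S u v].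

Lemma uniq_bruhat_lower v : uniq (bruhat_lower v).
Proof. exact: fset_uniq. Qed.

Lemma mem_bruhat_lower v z : z \in bruhat_lower v <-> bruhat S z v.
Proof.
rewrite /bruhat_lower in_fset_set ?in_setE //; exact: finite_bruhat_lower.
Qed.

(** At q = 1 the left side of the Kazhdan-Lusztig identity is [P u v] at 1. By induction on the
    length of [v] every term with [z] other than [v] has its expected value, and cancelling these
    leaves the term [z = v], where [P v v = 1]. *)
Lemma R_at1 u v : (R u v).[1] = (u == v)%:R.
Proof.
have [uv|nuv] := pselect (bruhat S u v); last first.
  rewrite (R_support hR nuv) horner0; case: eqP => // uv.
  by case: nuv; rewrite uv; exact: bruhat_refl.
elim/ltn_ind: {v}(len S v) {-2}v (leqnn (len S v)) uv => k IH v lev uv.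
have vI : v \in bruhat_lower v by apply/mem_bruhat_lower; exact: bruhat_refl.
have uI : u \in bruhat_lower v by exact/mem_bruhat_lower.
have : (P u v).[1] = \sum_(z <- bruhat_lower v) (u == z)%:R * (P z v).[1].
  rewrite (bigD1_seq u) ?uniq_bruhat_lower //= eqxx mul1r.
  by rewrite big1 ?addr0 // => z /negbTE; rewrite eq_sym => ->; rewrite mul0r.
rewrite -(horner_rev_poly (size_KL u v)).
rewrite (KL_poly (uniq_bruhat_lower v) (mem_bruhat_lower v) uv) horner_sum.
rewrite !(bigD1_seq v) ?uniq_bruhat_lower //= hornerM (KL_diag hP) hornerC !mulr1.
rewrite big_seq_cond [in X in _ = X]big_seq_cond.
rewrite (eq_bigr (fun z => (u == z)%:R * (P z v).[1])) => [/addIr //|z].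
case/andP=> /mem_bruhat_lower zv /eqP nzv; rewrite hornerM.
have [uz|nuz] := pselect (bruhat S u z); last first.
  rewrite (R_support hR nuz) horner0; case: eqP => [uz|_]; last by rewrite mul0r.
  by case: nuz; rewrite uz; exact: bruhat_refl.
rewrite (IH (len S z)) //; apply: leq_trans lev; rewrite ltn_neqAle bruhat_len //.
by rewrite andbT; apply/eqP => /(bruhat_len_eq zv).
Qed.

(** At x = 1 the argument [x - x^-1] vanishes, so only the constant term of [Rt u v] survives. *)
Lemma Rtilde_const u v : (Rt u v)`_0 = (u == v)%:R.
Proof.
have [uv|nuv] := pselect (bruhat S u v); last first.
  rewrite (Rtilde_support hRt nuv) coef0; case: eqP => // uv.
  by case: nuv; rewrite uv; exact: bruhat_refl.
rewrite -R_at1; have := congr1 (fun p => p.[1]) (R_twist uv).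
rewrite horner_comp hornerXn expr1n => ->.
rewrite /twist horner_sum big_ord_recl big1 => [|j _]; last first.
  rewrite hornerZ hornerM horner_exp hornerD hornerN hornerXn hornerC expr1n.
  by rewrite subrr expr0n mul0r mulr0.
by rewrite addr0 hornerZ hornerM expr0 hornerC hornerXn expr1n !mulr1.
Qed.

(* q^(-l(u,v)/2) P_{u,v} *)
Definition KL_coefs (u v : W) : coefs := laur (len2 S u v) (P u v \Po 'X^2).

Lemma KL_coefs_diag v : KL_coefs v v = delta0.
Proof.
rewrite /KL_coefs (KL_diag hP) comp_polyC /len2 subnn; apply: coefsP => k.
by rewrite /laur addr0 coefC /delta0; case: k => [] [|m].
Qed.

Lemma KL_coefs_neg u v : bruhat_lt S u v -> negpart (KL_coefs u v) = KL_coefs u v.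
Proof.
move=> uv; have deg := KL_deg hP uv; apply: coefsP => k; rewrite /negpart.
case: ltP => // k0; rewrite /KL_coefs /laur; case: ifP => // _.
rewrite coef_comp_poly_Xn //; case: ifP => // /dvdnP [m e].
have lm : (len2 S u v <= m * 2)%N by rewrite -e; lia.
rewrite e mulnK // nth_default //.
move: deg lm; set l := len2 S u v; set s := size _; lia.
Qed.

Lemma laur_R_mul u z v : bruhat S u z -> bruhat S z v ->
  laur (len2 S u v) ((R u z * P z v) \Po 'X^2) =
  \sum_(j < (len2 S u z).+1) mulxVX j (KL_coefs z v) *~ (Rt u z)`_j.
Proof.
move=> uz zv; rewrite (len2_bruhatD uz zv) rmorphM /= R_twist // mulr_suml raddf_sum.
apply: eq_bigr => j _; rewrite -scalerAl -{1}[_`_j]intz scaler_int raddfMz /=.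
rewrite -mulrA -[X in laur (X + _)](@subnKC j); last exact: (ltn_ord j).
by rewrite -addnA laur_mulxVX laurXn.
Qed.

Lemma big_ord_widen_Rtilde (m : nat) u z (F : nat -> coefs) :
  (len2 S u z <= m)%N ->
  \sum_(j < (len2 S u z).+1) F j *~ (Rt u z)`_j =
  \sum_(j < m.+1) F j *~ (Rt u z)`_j.
Proof.
move=> lem; rewrite (big_ord_widen _ (fun j => F j *~ (Rt u z)`_j) (lem : _ < m.+1)%N).
rewrite big_mkcond; apply: eq_bigr => j _; case: ltnP => // lj.
by rewrite nth_default ?mulr0z // (leq_trans (size_Rtilde _ _)).
Qed.

(* The truncated form of the Kazhdan-Lusztig identity: P_{u,v} has degree less
   than l(u,v)/2, while q^l(u,v) P_{u,v}(1/q) only has terms of larger degree. *)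
Lemma KL_coefs_rec u v : bruhat_lt S u v ->
  KL_coefs u v = - negpart (\sum_(j < len2 S u v)
    mulxVX j.+1 (\sum_(z <- bruhat_lower v) KL_coefs z v *~ (Rt u z)`_j.+1)).
Proof.
move=> uv; have [buv nuv] := uv; have deg := KL_deg hP uv.
set l := len2 S u v in deg *.
pose A (j : nat) := \sum_(z <- bruhat_lower v) KL_coefs z v *~ (Rt u z)`_j.
suff E : negpart (\sum_(j < l.+1) mulxVX j (A j)) = 0.
  (* The term [j = 0] is [KL_coefs u v] itself, because the constant term of [Rt u z] is 1 for
     [z = u] and 0 otherwise. *)
  move: E; rewrite big_ord_recl raddfD /= => /eqP; rewrite addr_eq0 => /eqP <-.
  rewrite /A (bigD1_seq u) ?uniq_bruhat_lower //=; last exact/mem_bruhat_lower.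
  rewrite big1 => [|z /negbTE zu]; last by rewrite Rtilde_const eq_sym zu mulr0z.
  by rewrite Rtilde_const eqxx addr0 KL_coefs_neg.
transitivity (negpart (laur l (rev_poly l (P u v) \Po 'X^2))).
  congr (negpart _).
  rewrite (KL_poly (uniq_bruhat_lower v) (mem_bruhat_lower v) buv).
  rewrite !raddf_sum /=; under eq_bigr do rewrite raddf_sum.
  rewrite exchange_big /= big_seq [RHS]big_seq; apply: eq_bigr => z.
  move=> /mem_bruhat_lower zv; under eq_bigr do rewrite raddfMz /=.
  have [uz|nuz] := pselect (bruhat S u z); last first.
    rewrite (R_support hR nuz) mul0r comp_poly0 raddf0 big1 // => j _.
    by rewrite (Rtilde_support hRt nuz) coef0 mulr0z.
  apply/esym; rewrite laur_R_mul //.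
  apply: (big_ord_widen_Rtilde (fun j => mulxVX j (KL_coefs z v))).
  by rewrite /l (len2_bruhatD uz zv) leq_addr.
apply: coefsP => k; rewrite /negpart; case: ltP => // k0.
rewrite /laur; case: ifP => // kl; rewrite coef_comp_poly_Xn //; case: ifP => //.
move=> /dvdnP [m e]; rewrite e mulnK // /rev_poly coef_sum big1 // => j _.
rewrite coefZ coefXn; case: eqP => [mj|]; last by rewrite mulr0.
have ml : (m * 2 < l)%N by rewrite -e; lia.
rewrite nth_default ?mul0r //; move: deg ml mj (ltn_ord j).
by move: (size _) (nat_of_ord j) => s i; lia.
Qed.
End KLcoefficients.

(** * Sums over chains *)

Fixpoint bits (m : nat) : seq (seq bool) :=
  if m is m'.+1 then map (cons false) (bits m') ++ map (cons true) (bits m')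
  else [:: [::]].

Lemma mem_bits m b : (b \in bits m) = (size b == m).
Proof.
elim: m b => [|m IH] [|x b] //=; rewrite mem_cat; first by rewrite orbC; elim: (bits m).
have inj y : injective (cons (y : bool)) by move=> ? ? [].
have nin y (s : seq (seq bool)) : x != y -> (x :: b \in map (cons y) s) = false.
  by move=> xy; apply/negP => /mapP [c _ [e _]]; rewrite e eqxx in xy.
by case: x nin => nin; rewrite mem_map // IH eqSS nin // orbF.
Qed.

Lemma uniq_bits m : uniq (bits m).
Proof.
have inj y : injective (cons (y : bool)) by move=> ? ? [].
elim: m => //= m IH; rewrite cat_uniq !map_inj_uniq // IH andbT /=.
by apply/hasPn => _ /mapP [b _ ->]; apply/negP => /mapP [c _ []].
Qed.

(* The composition [a + i_1, i_2 - i_1, ...] of [a + size b] whose partial sums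
   are the [a + i] for the (0-based) positions [i] of the [true]s of [b]. *)
Fixpoint comp_of_bits (a : nat) (b : seq bool) : seq nat :=
  match b with
  | [::] => [:: a]
  | true :: b' => a :: comp_of_bits 1 b'
  | false :: b' => comp_of_bits a.+1 b'
  end.

Lemma comp_of_bits_gt0 a b : (0 < a)%N -> composition (comp_of_bits a b).
Proof. by elim: b a => [|[] b IH] a a0 /=; rewrite /composition /= ?a0 //; apply: IH. Qed.

Lemma sumn_comp_of_bits a b : sumn (comp_of_bits a b) = (a + size b)%N.
Proof. by elim: b a => [|[] b IH] a //=; rewrite IH; lia. Qed.

Lemma comp_of_bits_neq0 a b : comp_of_bits a b != [::].
Proof. by elim: b a => [|[] b IH] a //=. Qed.

(* Reads [b] from right to left, a [true] standing for the truncation that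
   separates two consecutive factors of a chain. *)
Fixpoint bits_coefs (b : seq bool) : coefs :=
  match b with
  | [::] => mulxV delta0
  | true :: b' => mulxV (- negpart (bits_coefs b'))
  | false :: b' => mulxV (bits_coefs b')
  end.

(** The exponent vector with entries [al] on the first variables; a quasisymmetric series has there
    its coefficient of M_al. *)
Definition exponent (al : seq nat) : monom :=
  [fsfun j in seq_fset tt (iota 0 (size al)) => nth 0%N al j].

Lemma exponentE al j : exponent al j = nth 0%N al j.
Proof.
rewrite fsfunE seq_fsetE mem_iota /= add0n; case: ltnP => // h.
by rewrite nth_default.
Qed.

Fixpoint seqs_of (I : eqType) (r : seq I) (k : nat) : seq (seq I) :=
  if k is k'.+1 then [seq z :: s | z <- r, s <- seqs_of r k'] else [:: [::]].

Lemma mem_seqs_of (I : eqType) (r : seq I) k s :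
  (s \in seqs_of r k) = (size s == k) && all (mem r) s.
Proof.
elim: k s => [|k IH] [|z s] //=; first by apply/negP => /allpairsP [[? ?] []].
apply/allpairsP/idP => [[[x t] /= [xr tr [-> ->]]]|/and3P [sz zr sr]].
  by move: tr; rewrite IH eqSS xr => /andP [-> ->].
by exists (z, s); rewrite /= IH zr sr -eqSS sz.
Qed.

Lemma uniq_seqs_of (I : eqType) (r : seq I) k : uniq r -> uniq (seqs_of r k).
Proof.
by move=> ur; elim: k => //= k IH; apply: allpairs_uniq => // [[? ?] [? ?] _ _ [-> ->]].
Qed.

Section Chains.
Variables (W : groupType) (S : set W) (H : algType laurent) (T : W -> H).
Variables (R Rt P : W -> W -> {poly int}).
Hypothesis coxS : coxeter_system S.
Hypothesis hR : R_polynomials S T R.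
Hypothesis hRt : Rtilde_polynomials S R Rt.
Hypothesis hP : KL_polynomials S R P.

Fixpoint path_coef (u : W) (s : seq W) (al : seq nat) : int :=
  match s, al with
  | z :: s', a :: al' => (Rt u z)`_a * path_coef z s' al'
  | [::], [::] => 1
  | _, _ => 0
  end.

(** The steps need not be required to ascend, as [Rt u z] is 0 otherwise; confining them to the
    lower interval of [v] makes the sum finite. *)
Fixpoint chain_sum (v : W) (al : seq nat) (u : W) : int :=
  if al is a :: al' then
    \sum_(z <- bruhat_lower S v) (Rt u z)`_a * chain_sum v al' z
  else (u == v)%:R.

Lemma chain_sumE v al u :
  \sum_(s <- seqs_of (bruhat_lower S v) (size al) | last u s == v)
    path_coef u s al = chain_sum v al u.
Proof.
elim: al u => [|a al IH] u /=; first by rewrite big_mkcond big_seq1; case: eqP.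
rewrite big_mkcond big_allpairs_dep; apply: eq_bigr => z _.
by rewrite -big_mkcond /= -IH mulr_sumr.
Qed.

Lemma separated_prodE u s al : size s = size al ->
  separated_prod (pairmap Rt u s) (exponent al) = path_coef u s al.
Proof.
move=> sz; rewrite /separated_prod ifT; last first.
  apply/allP => j; rewrite mem_finsupp exponentE size_pairmap sz.
  by case: ltnP => // h; rewrite nth_default.
rewrite size_pairmap sz; under eq_bigr do rewrite exponentE.
elim: al u s sz => [|a al IH] u [|z s] //=; first by rewrite big_ord0.
by case=> /IH IHs; rewrite big_ord_recl /= -IHs.
Qed.

Lemma separated_prod_short u s al : composition al -> (size s < size al)%N ->
  separated_prod (pairmap Rt u s) (exponent al) = 0.
Proof.
move=> al0 lt; rewrite /separated_prod ifF //; apply/negP => /allP /(_ (size s)).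
rewrite size_pairmap ltnn mem_finsupp exponentE -lt0n => h.
by have := h (elimT (all_nthP 0%N) al0 _ lt).
Qed.

Lemma multichain_le u v c : multichain S u v c -> forall j, (j < size c)%N ->
  bruhat S (nth u c j) v.
Proof.
case=> k [-> _ ev step _] j; rewrite ltnS => jk; rewrite -(subKn jk).
elim: (k.+1 - j)%N (leq_subr j k.+1) => [|i IH] ik.
  by rewrite subn0 ev; exact: bruhat_refl.
apply: (rt_trans _ _ _ _ _ _ (IH (ltnW ik))).
by rewrite subSS subSn //; apply: step; exact: leq_subr.
Qed.

(** Only multichains with [size al] steps matter: a shorter one lacks a variable, and in a longer
    one the last factor contributes its constant term, which is 0 because the last step is strict.
    Conversely, a sequence of nonzero weight ascends, and its last step is strict because [Rt v v]
    has degree 0 while the last part of [al] is positive. *)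
Lemma Ftilde_exponent u v al : composition al -> al != [::] ->
  Ftilde S Rt u v (exponent al) = chain_sum v al u.
Proof.
move=> al0 aln; set e := exponent al; rewrite /Ftilde -chain_sumE.
pose r := [seq u :: s | s <- seqs_of (bruhat_lower S v) (size al) & last u s == v].
have ur : uniq r.
  rewrite map_inj_uniq => [|s t []//].
  by rewrite filter_uniq // uniq_seqs_of // uniq_bruhat_lower.
rewrite (fsbigE [seq c <- r | `[< multichain S u v c >]]); first last.
- move=> c mc; rewrite mem_filter asboolT //= => cr.
  have := multichain_le mc; case: mc => k [].
  case: c cr => [|u' s] // cr [sz] /= eu ev step last_neq le.
  rewrite {u'}eu in cr step last_neq le *.
  have lastv : last u s = v by rewrite -nth_last sz.
  rewrite /chain_weight /=; have [lt|gt|eq] := ltngtP (size s) (size al).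
  + exact: separated_prod_short.
  + rewrite /separated_prod; case: ifP => // _.
    have kp : (k < size (pairmap Rt u s))%N by rewrite size_pairmap sz.
    rewrite (bigD1 (Ordinal kp)) //= (nth_pairmap u) ?sz // exponentE.
    rewrite (nth_default 0%N); last by rewrite -ltnS -sz.
    rewrite (Rtilde_const coxS hR hRt hP).
    by rewrite ev; case: eqP last_neq => // _ _; rewrite mul0r.
  + case/negP: cr; apply/mapP; exists s => //; rewrite mem_filter lastv eqxx.
    rewrite mem_seqs_of eq eqxx; apply/allP => z /(nthP u) [j js <-].
    by apply/mem_bruhat_lower => //; exact: (le j.+1).
- by move=> c /=; rewrite mem_filter => /andP [/asboolP].
- by rewrite filter_uniq.
rewrite big_filter_cond big_mkcond.
transitivity (\sum_(c <- r) chain_weight Rt u c e); last first.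
  rewrite big_map big_filter big_seq_cond [RHS]big_seq_cond; apply: eq_bigr => s.
  by rewrite mem_seqs_of => /andP [/andP [/eqP sz _] _]; exact: separated_prodE.
rewrite big_seq [RHS]big_seq; apply: eq_bigr => c; case/mapP=> s; rewrite mem_filter.
rewrite mem_seqs_of => /andP [/eqP lastv /andP [/eqP sz _]] -> {c}.
case: ifPn => // nm; apply/esym/eqP; apply: contraNT nm => nz.
suff mc : multichain S u v (u :: s) by rewrite asboolT // inE.
move: nz; rewrite /chain_weight /= /separated_prod.
case: ifP; rewrite ?eqxx // => _; rewrite size_pairmap => /prodf_neq0 nz.
have nzj j : (j < size s)%N ->
    (Rt (nth u (u :: s) j) (nth u s j))`_(nth 0%N al j) != 0.
  by move=> js; have := nz (Ordinal js) isT; rewrite /= (nth_pairmap u) // exponentE.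
case sz': (size s) => [|k].
  by case: al aln sz' sz {al0 e r ur nz nzj} => // ? ? _ ->.
exists k; split=> //=; rewrite ?sz' //.
- by rewrite -lastv -nth_last sz'.
- by move=> j jk; have := nzj j; rewrite sz' ltnS => /(_ jk)/(Rtilde_neq0 hRt) [].
- have vE : nth u s k = v by rewrite -lastv -nth_last sz'.
  have := nzj k; rewrite sz' leqnn vE => /(_ isT) nzk eqv; move: nzk.
  rewrite eqv => /(Rtilde_neq0 hRt) [_]; rewrite /len2 subnn leqNgt => /negP; apply.
  by apply: (elimT (all_nthP 0%N) al0); rewrite -sz sz'.
Qed.

(** Here [a] is the portion of the first part already read, and only the last of its factors y is
    counted. A next bit [false] prolongs this part to [a.+1]; a bit [true] closes it at some [z],
    where the truncated recursion turns the remaining sum into [KL_coefs z v]. The bound on [B]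
    ensures that the omitted compositions contribute nothing. *)
Lemma bits_coefs_sum (v : W) (B a : nat) (u : W) :
  bruhat S u v -> (0 < a)%N -> (len2 S u v < B + a)%N ->
  \sum_(m < B) \sum_(b <- bits m)
     bits_coefs b *~ chain_sum v (comp_of_bits a b) u =
  \sum_(a <= j < (len2 S u v).+1)
     mulxVX (j - a).+1
       (\sum_(z <- bruhat_lower S v) KL_coefs S P z v *~ (Rt u z)`_j).
Proof.
elim: B a u => [|B IH] a u uv a0 lt; first by rewrite big_ord0 big_geq.
pose D j := \sum_(z <- bruhat_lower S v) KL_coefs S P z v *~ (Rt u z)`_j.
pose Q z := \sum_(m < B) \sum_(b <- bits m)
     bits_coefs b *~ chain_sum v (comp_of_bits 1 b) z.
have -> : \sum_(a <= j < (len2 S u v).+1) mulxVX (j - a).+1 (D j) =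
    mulxV (D a) + mulxV (\sum_(a.+1 <= j < (len2 S u v).+1)
                            mulxVX (j - a.+1).+1 (D j)).
  have [al|la] := leqP a (len2 S u v).
    rewrite big_ltn ?ltnS // subnn; congr (_ + _); rewrite raddf_sum /=.
    rewrite big_nat_cond [RHS]big_nat_cond; apply: eq_bigr => j.
    by case/andP=> /andP [aj _] _; rewrite -!mulxVXS subnSK.
  (* Past [len2 S u v] there is no term [j = a]: a nonzero coefficient would give
     [a <= len2 S u z <= len2 S u v]. *)
  suff -> : D a = 0.
    by rewrite [LHS]big_geq // big_geq ?raddf0 ?addr0 //; exact: ltnW.
  rewrite /D big_seq big1 // => z /mem_bruhat_lower zv.
  have [->|nz] := eqVneq (Rt u z)`_a 0; first by rewrite mulr0z.
  have [uz] := Rtilde_neq0 hRt nz.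
  have := len2_bruhatD uz (zv coxS); lia.
rewrite -IH //; last by rewrite addnS.
rewrite big_ord_recl /= big_seq1.
under eq_bigr do rewrite big_cat !big_map /=.
rewrite big_split /= addrCA addrC; congr (_ + _); last first.
  by rewrite raddf_sum; apply: eq_bigr => m _; rewrite raddf_sum;
    apply: eq_bigr => b _; rewrite raddfMz.
transitivity (mulxV (\sum_(z <- bruhat_lower S v)
    (delta0 *~ (z == v)%:R - negpart (Q z)) *~ (Rt u z)`_a)).
  rewrite (eq_bigr (fun z => delta0 *~ ((Rt u z)`_a * (z == v)%:R) +
      - negpart (Q z) *~ (Rt u z)`_a)); last first.
    by move=> z _; rewrite mulrzDl mulrzA_C mulrzA.
  rewrite big_split raddfD /= -mulrz_sumr raddfMz /=; congr (_ + _).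
  transitivity (\sum_(z <- bruhat_lower S v) \sum_(m < B) \sum_(b <- bits m)
      mulxV (- negpart (bits_coefs b)) *~
        ((Rt u z)`_a * chain_sum v (comp_of_bits 1 b) z)).
    rewrite [RHS]exchange_big; apply: eq_bigr => m _.
    rewrite [RHS]exchange_big; apply: eq_bigr => b _.
    by rewrite mulrz_sumr.
  rewrite raddf_sum; apply: eq_bigr => z _; rewrite raddfMz /Q.
  rewrite (raddf_sum negpart) -sumrN raddf_sum mulrz_suml; apply: eq_bigr => m _.
  rewrite (raddf_sum negpart) -sumrN raddf_sum mulrz_suml; apply: eq_bigr => b _.
  by rewrite raddfMz -mulNrz raddfMz -mulrzA mulrC.
congr (mulxV _); rewrite /D big_seq [RHS]big_seq; apply: eq_bigr => z zv.
have [->|nz] := eqVneq (Rt u z)`_a 0; first by rewrite !mulr0z.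
have [uz az] := Rtilde_neq0 hRt nz; have /mem_bruhat_lower -/(_ coxS) zv' := zv.
have lzv := len2_bruhatD uz zv'.
(* From [a <= len2 S u z] the bound for [z] with initial portion 1 follows: [len2 S z v < B + 1]. *)
congr (_ *~ _); rewrite /Q IH //; last by lia.
have [e|/eqP zv0] := eqVneq z v.
  rewrite e big_geq ?raddf0 ?subr0; last by rewrite /len2 subnn.
  by rewrite (KL_coefs_diag hP).
rewrite mulr0z add0r (KL_coefs_rec coxS hR hRt hP (conj zv' zv0)).
rewrite big_add1 big_mkord; congr (- negpart _); apply: eq_bigr => j _.
by rewrite subn1.
Qed.

(** The case [a = 1]. [B] stays free above [len2 S u v] so that it can also be taken beyond the
    degrees of all words in the support of [psi]. *)
Lemma KL_coefs_bits u v B : bruhat_lt S u v -> (len2 S u v <= B)%N ->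
  KL_coefs S P u v = - negpart (\sum_(m < B) \sum_(b <- bits m)
    bits_coefs b *~ Ftilde S Rt u v (exponent (comp_of_bits 1 b))).
Proof.
move=> uv lB; rewrite (KL_coefs_rec coxS hR hRt hP uv); congr (- negpart _).
transitivity (\sum_(1 <= j < (len2 S u v).+1) mulxVX (j - 1).+1
    (\sum_(z <- bruhat_lower S v) KL_coefs S P z v *~ (Rt u z)`_j)).
  by rewrite big_add1 big_mkord; apply: eq_bigr => j _; rewrite subn1.
rewrite -(@bits_coefs_sum _ B) ?addn1 //; last by case: uv.
apply: eq_bigr => m _; apply: eq_bigr => b _.
by rewrite Ftilde_exponent ?comp_of_bits_gt0 ?comp_of_bits_neq0.
Qed.

End Chains.

(** * Coefficients of Theta *)

Lemma composition_nth_gt0 (al : seq nat) j :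
  composition al -> (0 < nth 0%N al j)%N = (j < size al)%N.
Proof.
move=> al0; case: (ltnP j) => [js|sj]; last by rewrite nth_default.
exact: (elimT (all_nthP 0%N) al0).
Qed.

(** All parts being positive, the support of the exponent forces the increasing index sequence to be
    0, 1, 2, and so on. *)
Lemma monomial_qsym_exponent (be al : seq nat) :
  composition be -> composition al ->
  monomial_qsym be (exponent al) = (be == al)%:R.
Proof.
move=> be0 al0; rewrite /monomial_qsym; congr ((_ : bool)%:R).
apply/asboolP/eqP => [[i [si sz ei]]|->]; last first.
  exists (iota 0 (size al)); split; first exact: iota_ltn_sorted.
    by rewrite size_iota.
  move=> j; rewrite exponentE; case: (ltnP j (size al)) => js.
    by rewrite -[X in index X]add0n -(nth_iota 0 0 js) index_uniq ?size_iota ?iota_uniq.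
  by rewrite !nth_default // memNindex ?size_iota // mem_iota /= add0n -leqNgt.
have memi j : (j \in i) = (j < size al)%N.
  rewrite -index_mem sz -(composition_nth_gt0 _ be0) -ei exponentE.
  exact: composition_nth_gt0.
have ii : i = iota 0 (size al).
  apply: (irr_sorted_eq ltn_trans ltnn si (iota_ltn_sorted _ _)) => j.
  by rewrite memi mem_iota add0n.
have szE : size be = size al by rewrite -sz ii size_iota.
apply: (eq_from_nth (x0 := 0%N)) => // j; rewrite szE => js.
have := ei j; rewrite exponentE ii => ->.
by rewrite -[X in index X]add0n -(nth_iota 0 0 js) index_uniq ?size_iota ?iota_uniq.
Qed.

Lemma fundamental_qsym_exponent (be al : seq nat) : composition al ->
  fundamental_qsym be (exponent al) = `[< refines al be >]%:R.
Proof.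
move=> al0; rewrite /fundamental_qsym.
rewrite (fsbigE [seq x <- [:: al] | `[< refines x be >]]).
- rewrite /=; case: ifPn => [r|_]; last by rewrite big_nil.
  rewrite big_mkcond big_seq1 monomial_qsym_exponent // eqxx.
  by rewrite ifT // inE; split=> //; apply/asboolP.
- by rewrite filter_uniq.
- by move=> x /=; case: asboolP => // rx; rewrite inE => /eqP ->.
move=> x [x0 rx]; rewrite mem_filter asboolT //= inE => nx.
by rewrite monomial_qsym_exponent // (negbTE nx).
Qed.

(* The condition on a refinement [bs0 :: bs] of [comp_of_bits (k + a) t], where
   [k] is a part of the first block that has already been read. *)
Lemma refines_comp_of_bits_aux (a k : nat) (b t : seq bool) : (0 < a)%N ->
  (exists bs0 bs, comp_of_bits a b = bs0 ++ flatten bs /\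
     comp_of_bits (k + a) t = (k + sumn bs0)%N :: map sumn bs) <->
  all2 implb t b.
Proof.
elim: b a k t => [|x b IH] a k t a0.
  split=> [[bs0 [bs [e1 e2]]]|]; last first.
    by case: t => // _; exists [:: a], [::]; rewrite /= addn0.
  have := congr1 sumn e2; have := congr1 sumn e1.
  rewrite /= sumn_cat !sumn_flatten sumn_comp_of_bits.
  by case: t {e2} => //= y t; lia.
case: t => [|y t].
  split=> // [] [bs0 [bs [e1 e2]]].
  have := congr1 sumn e2; have := congr1 sumn e1.
  by rewrite sumn_cat !sumn_flatten sumn_comp_of_bits /=; lia.
have head_ge (c : nat) s r : comp_of_bits c s = r -> (c <= head 0 r)%N.
  by move=> <-; elim: s c {IH} => [|[] s IHs] c //=; rewrite ltnW.
case: x; case: y => /=; first last.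
- by rewrite -addnS; exact: IH.
- split=> // [] [[|c bs0] [bs [/head_ge /= h1 [e2 _]]]]; lia.
- have := IH 1%N (k + a)%N t isT; rewrite addn1 => <-.
  split=> [] [bs0 [bs [e1 e2]]].
    case: bs0 e1 e2 => [|c bs0] /=.
      by move=> _ /head_ge /=; rewrite addn0; lia.
    by case=> <- ->; rewrite addnA => e2; exists bs0, bs.
  by exists (a :: bs0), bs; rewrite /= e1 addnA.
rewrite -(IH 1%N 0%N t) //; split; last first.
  case=> bs0 [bs [e1 e2]].
  by exists [:: a], (bs0 :: bs); rewrite /= e1 addn0; split; last by congr (_ :: _).
case=> bs0 [bs [e1 [e2 e3]]].
have {e2} : sumn bs0 = a by lia.
case: bs0 e1 => [|c bs0] /=; first by lia.
(* The part [a] already exhausts the sum of this block, so a further positive part cannot belong to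
   it. *)
case=> <- eb sz; have bs00 : bs0 = [::].
  have := comp_of_bits_gt0 b (isT : 0 < 1)%N; rewrite eb /composition all_cat.
  by case: bs0 {eb} sz => //= d bs0 sz /andP [/andP []]; lia.
move: eb e3; rewrite bs00 /=; case: bs => [|bs0' bs] /=.
  by move=> /eqP; rewrite (negbTE (comp_of_bits_neq0 _ _)).
by move=> -> ->; exists bs0', bs.
Qed.

Lemma refines_comp_of_bits (b t : seq bool) :
  refines (comp_of_bits 1 b) (comp_of_bits 1 t) <-> all2 implb t b.
Proof.
rewrite -(refines_comp_of_bits_aux 0 b t (isT : 0 < 1)%N) /refines.
split=> [[[|bs0 bs] [<- e]]|[bs0 [bs [-> e]]]].
- by have := comp_of_bits_neq0 1 t; rewrite -e.
- by exists bs0, bs.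
by exists (bs0 :: bs).
Qed.

Definition set_bits (m : nat) (T : {set 'I_m.+1}) : seq bool :=
  [seq inord i \in T | i <- iota 1 m].

(** [s] is the last partial sum met and [a] the length gained since then. *)
Lemma pairmap_subn_iota (P : pred nat) (s a m : nat) :
  pairmap (fun x y => (y - x)%N) s
    (rcons [seq i <- iota (s + a) m | P i] (s + a + m)%N) =
  comp_of_bits a [seq P i | i <- iota (s + a) m].
Proof.
elim: m s a => [|m IH] s a /=; first by rewrite addn0 addKn.
case: (P (s + a)%N) => /=; last by rewrite -addSnnS -addnS IH.
by rewrite addKn -addSnnS -[(s + a).+1]addn1 IH.
Qed.

Lemma comp_of_setE (m : nat) (T : {set 'I_m.+1}) : T \subset interval1 m ->
  comp_of_set T = comp_of_bits 1 (set_bits T).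
Proof.
move=> T1; rewrite /comp_of_set /set_bits.
have := pairmap_subn_iota (fun i => inord i \in T) 0 1 m; rewrite add0n add1n => <-.
congr (pairmap _ _ (rcons _ _)); rewrite /enum_mem -enumT.
rewrite -[iota 1 m]/(behead (iota 0 m.+1)) -val_enum_ord.
rewrite (eq_filter (a2 := preim val (fun i => inord i \in T))) => [|i]; last first.
  by rewrite /= inord_val.
rewrite -filter_map val_enum_ord /= ifN //.
by apply/negP => /(fintype.subsetP T1); rewrite inE inordK.
Qed.

Lemma set_bits_perm (m : nat) :
  perm_eq (bits m)
    [seq set_bits T | T <- enum [pred T : {set 'I_m.+1} | T \subset interval1 m]].
Proof.
apply: uniq_perm; first exact: uniq_bits.
  rewrite map_inj_in_uniq ?enum_uniq // => A B.
  rewrite !mem_enum !inE => /fintype.subsetP A1 /fintype.subsetP B1 /eq_in_map AB.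
  apply/setP => i; have [i0|i0] := posnP i.
    by apply/idP/idP => [/A1|/B1]; rewrite inE i0.
  by have := AB i; rewrite mem_iota i0 /= add1n ltn_ord inord_val; apply.
move=> t; rewrite mem_bits; apply/eqP/mapP => [sz|[A _ ->]]; last first.
  by rewrite size_map size_iota.
exists [set i : 'I_m.+1 | (0 < i)%N && nth false t i.-1]%SET.
  by rewrite mem_enum !inE; apply/fintype.subsetP => i; rewrite !inE => /andP [].
apply: (eq_from_nth (x0 := false)); first by rewrite size_map size_iota.
move=> i; rewrite sz => im; rewrite (nth_map 0%N) ?size_iota // nth_iota //.
by rewrite inE inordK //= ltnS.
Qed.

Lemma big_set_bits (m : nat) (Q : pred (seq bool)) (G : seq bool -> int) :
  \sum_(T : {set 'I_m.+1} | (T \subset interval1 m) && Q (set_bits T))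
    G (set_bits T) = \sum_(t <- bits m | Q t) G t.
Proof. by rewrite (perm_big _ (set_bits_perm m)) big_map big_enum_cond. Qed.

Fixpoint admissible (w : cdword) (t : seq bool) : bool :=
  match w, t with
  | [::], [::] => true
  | Lc :: w', _ :: t' => admissible w' t'
  | Ld :: w', x :: y :: t' => (x != y) && admissible w' t'
  | _, _ => false
  end.

Lemma dpos_cons x w :
  dpos (x :: w) = (if x is Ld then [:: 2%N] else [::]) ++
                  [seq (letter_deg x + i)%N | i <- dpos w].
Proof.
rewrite /dpos /= -[1%N]addn0 iotaDl filter_map.
by case: x; rewrite /= ?take0 -!map_comp.
Qed.

Lemma dpos_bounds w : all (fun i => 1 < i <= wdeg w)%N (dpos w).
Proof.
elim: w => // x w IH; rewrite dpos_cons all_cat all_map.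
apply/andP; split; first by case: x.
by apply: sub_all IH => i /=; rewrite /wdeg /=; case: x => /=; lia.
Qed.

Lemma admissibleE (P : pred nat) (s : nat) (w : cdword) :
  admissible w [seq P i | i <- iota s.+1 (wdeg w)] =
  all (fun i => P (s + i).-1 != P (s + i)%N) (dpos w).
Proof.
elim: w s => // x w IH s; rewrite dpos_cons all_cat all_map.
case: x; rewrite /= add0n -/(wdeg w) IH.
  by apply: eq_all => i; rewrite /= !addnA addn1.
rewrite andbT addn2 /=; congr (_ && _).
by apply: eq_all => i; rewrite /= !addnA addn2.
Qed.

(** A set and its complement both meet a block of two positions exactly when one of the two
    positions is in the set. *)
Lemma meets_dblocksE (w : cdword) (T : {set 'I_(wdeg w).+1}) :
  T \subset interval1 (wdeg w) ->
  meets_dblocks w T && meets_dblocks w (interval1 (wdeg w) :\: T)%SET =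
  admissible w (set_bits T).
Proof.
move=> T1; rewrite /set_bits (admissibleE (fun i => inord i \in T) 0).
rewrite /meets_dblocks -all_predI; apply: eq_in_all => i /(allP (dpos_bounds w)).
move=> /andP [i1 im] /=; rewrite add0n.
have ex (A : {set 'I_(wdeg w).+1}) :
    [exists k in A, (val k == i.-1) || (val k == i)] =
    (inord i.-1 \in A) || (inord i \in A).
  apply/existsP/orP => [[k /andP [kA /orP [] /eqP ki]]|[] kA].
  - by left; rewrite -ki inord_val.
  - by right; rewrite -ki inord_val.
  - exists (inord i.-1); rewrite kA val_insubd ltnS.
    by rewrite (leq_trans (leq_pred _) im) eqxx.
  - by exists (inord i); rewrite kA val_insubd ltnS im eqxx orbT.
have im' : (i.-1 <= wdeg w)%N by exact: leq_trans (leq_pred _) im.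
have i0 : (0 < i)%N by exact: ltnW.
have i'0 : (0 < i.-1)%N by rewrite -ltnS prednK.
rewrite !ex !inE !inordK ?ltnS // i0 i'0 !andbT.
by case: (_ \in T); case: (_ \in T).
Qed.

Lemma Theta_exponent (w : cdword) (b : seq bool) :
  Theta w (exponent (comp_of_bits 1 b)) =
  \sum_(t <- bits (wdeg w) | admissible w t) (all2 implb t b)%:R.
Proof.
rewrite -big_set_bits /Theta.
rewrite (eq_bigl (fun T : {set 'I_(wdeg w).+1} =>
  (T \subset interval1 (wdeg w)) && admissible w (set_bits T))); last first.
  by move=> T; case T1: (_ \subset _) => //=; rewrite meets_dblocksE.
apply: eq_bigr => T /andP [T1 _].
rewrite comp_of_setE // fundamental_qsym_exponent ?comp_of_bits_gt0 //.
by congr ((_ : bool)%:R); apply/asboolP/idP; rewrite -refines_comp_of_bits.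
Qed.

(** * The operators attached to cd-words *)

Definition num_admissible (w : cdword) (b : seq bool) : int :=
  \sum_(t <- bits (wdeg w) | admissible w t) (all2 implb t b)%:R.

(** The image of Theta_w under the functional on quasisymmetric functions, before its outermost
    truncation [- negpart]. *)
Definition wcoefs (w : cdword) : coefs :=
  \sum_(b <- bits (wdeg w)) bits_coefs b *~ num_admissible w b.

Lemma all2_size (A B : Type) (r : A -> B -> bool) s t :
  all2 r s t -> size s = size t.
Proof. by elim: s t => [|x s IH] [|y t] //= /andP [_ /IH ->]. Qed.

(** Theta_w is homogeneous of degree [(wdeg w).+1], so only [m = wdeg w] contributes. *)
Lemma wcoefs_sum (w : cdword) (B : nat) : (wdeg w < B)%N ->
  \sum_(m < B) \sum_(b <- bits m)
    bits_coefs b *~ Theta w (exponent (comp_of_bits 1 b)) = wcoefs w.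
Proof.
move=> lB; rewrite (bigD1 (Ordinal lB)) //= [X in _ + X]big1 ?addr0.
  by apply: eq_bigr => b _; rewrite Theta_exponent.
move=> m ne; rewrite big_seq big1 // => b; rewrite mem_bits => /eqP sb.
rewrite Theta_exponent big_seq_cond big1 ?mulr0z // => t.
rewrite mem_bits => /andP [/eqP st _]; case: (boolP (all2 _ _ _)) => // /all2_size.
by move=> e; case/eqP: ne; apply: val_inj; rewrite /= -sb -e st.
Qed.

Lemma num_admissible_c w x b :
  num_admissible (Lc :: w) (x :: b) = num_admissible w b *+ x.+1.
Proof.
rewrite /num_admissible (_ : wdeg (Lc :: w) = (wdeg w).+1) //=.
rewrite big_cat !big_map /=; case: x => //=.
by rewrite [X in _ + X]big1 ?addr0.
Qed.

(** Of the two admissible pairs, [true, false] lies below [x, y] if [x] holds, and [false, true] if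
    [y] does. *)
Lemma num_admissible_d w x y b :
  num_admissible (Ld :: w) [:: x, y & b] = num_admissible w b *+ (x + y).
Proof.
rewrite /num_admissible (_ : wdeg (Ld :: w) = (wdeg w).+2) //=.
rewrite !(big_cat, big_map) /=.
rewrite !big_pred0_eq add0r addr0; have z : \sum_(t <- bits (wdeg w) |
    admissible w t) (false && all2 implb t b)%:R = 0 :> int by rewrite big1.
by case: x; case: y; rewrite ?z ?addr0 ?add0r ?mulr2n.
Qed.

Lemma wcoefs_nil : wcoefs [::] = mulxV delta0.
Proof.
by rewrite /wcoefs big_seq1 /num_admissible big_mkcond big_seq1.
Qed.

Lemma wcoefs_c w :
  wcoefs (Lc :: w) = mulxV (wcoefs w - negpart (wcoefs w) *+ 2).
Proof.
rewrite {1}/wcoefs (_ : wdeg (Lc :: w) = (wdeg w).+1) //= big_cat !big_map /=.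
rewrite raddfB raddfMn /= /wcoefs; congr (_ + _).
  rewrite raddf_sum; apply: eq_bigr => b _.
  by rewrite num_admissible_c raddfMz.
rewrite !raddf_sum -sumrMnl -sumrN; apply: eq_bigr => b _.
rewrite num_admissible_c raddfN mulNrz; congr (- _).
by rewrite !raddfMz !mulr2n mulrzDr.
Qed.

Lemma wcoefs_d w (K := wcoefs w) :
  wcoefs (Ld :: w) = mulxV (- negpart (mulxV K) - mulxV (negpart K)
     + negpart (mulxV (negpart K)) *+ 2).
Proof.
rewrite {1}/wcoefs (_ : wdeg (Ld :: w) = (wdeg w).+2) //= !(big_cat, big_map) /=.
rewrite big1 ?add0r => [|b _]; last by rewrite num_admissible_d mulr0n mulr0z.
have -> : \sum_(b <- bits (wdeg w)) mulxV (mulxV (- negpart (bits_coefs b))) *~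
    num_admissible (Ld :: w) [:: false, true & b] = mulxV (- mulxV (negpart K)).
  rewrite /K /wcoefs (raddf_sum negpart) (raddf_sum mulxV) -sumrN.
  rewrite (raddf_sum mulxV); apply: eq_bigr => b _.
  by rewrite num_admissible_d !raddfN !raddfMz.
have -> : \sum_(b <- bits (wdeg w)) mulxV (- negpart (mulxV (bits_coefs b))) *~
    num_admissible (Ld :: w) [:: true, false & b] = mulxV (- negpart (mulxV K)).
  rewrite /K /wcoefs (raddf_sum mulxV) (raddf_sum negpart) -sumrN.
  rewrite (raddf_sum mulxV); apply: eq_bigr => b _.
  by rewrite num_admissible_d !raddfN !raddfMz.
have -> : \sum_(b <- bits (wdeg w))
    mulxV (- negpart (mulxV (- negpart (bits_coefs b)))) *~
    num_admissible (Ld :: w) [:: true, true & b] =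
    mulxV (negpart (mulxV (negpart K)) *+ 2).
  rewrite /K /wcoefs (raddf_sum negpart) (raddf_sum mulxV) (raddf_sum negpart).
  rewrite -sumrMnl (raddf_sum mulxV); apply: eq_bigr => b _.
  rewrite num_admissible_d (_ : (true + true)%N = 2%N) // !mulr2n mulrzDr.
  rewrite !(raddfN mulxV, raddfN negpart) opprK (raddfD mulxV).
  by rewrite !(raddfMz negpart, raddfMz mulxV).
by rewrite -!(raddfD mulxV) addrCA addrA.
Qed.

(** * Antisymmetry and factorization at the letters d *)

Definition antisymmetric_coefs (f : coefs) : Prop := forall k, f (- k) = - f k.

Lemma antisymmetric_coefs0 f : antisymmetric_coefs f -> f 0 = 0.
Proof. by move=> /(_ 0); rewrite oppr0; move: (f 0) => x; lia. Qed.

Lemma sub_negpartE f k : (f - negpart f *+ 2) k = if k < 0 then - f k else f k.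
Proof.
by rewrite coefsB mulr2n coefsD /negpart; case: ifP => _; rewrite ?subr0 //; lia.
Qed.

(** Changing the sign of the negative half makes [f] symmetric, and [x - x^-1] is antisymmetric. *)
Lemma antisymmetric_wcoefs_c f : antisymmetric_coefs f ->
  antisymmetric_coefs (mulxV (f - negpart f *+ 2)).
Proof.
move=> af; have ev k : (f - negpart f *+ 2) (- k) = (f - negpart f *+ 2) k.
  rewrite !sub_negpartE af oppr_lt0.
  case: (ltgtP k 0) => [//|_|->]; first by rewrite opprK.
  by rewrite (antisymmetric_coefs0 af) oppr0.
move: (f - _) ev => g ev k; rewrite /mulxV opprB -(ev (k + 1)) -(ev (k - 1)).
by rewrite opprD opprB (addrC 1).
Qed.

Lemma mulxV_delta0_antisymmetric : antisymmetric_coefs (mulxV delta0).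
Proof.
move=> k; rewrite /mulxV /delta0 opprB.
rewrite (_ : (- k - 1 == 0) = (k + 1 == 0)); last by lia.
by rewrite (_ : (- k + 1 == 0) = (k - 1 == 0)) //; lia.
Qed.

(* Antisymmetry kills the constant term of [f], so that the two truncations
   only leave the coefficient of [f] at x. *)
Lemma antisymmetric_wcoefs_d f : antisymmetric_coefs f ->
  - negpart (mulxV f) - mulxV (negpart f) + negpart (mulxV (negpart f)) *+ 2 =
  delta0 *~ f 1.
Proof.
move=> af; have f0 := antisymmetric_coefs0 af.
have f1 := af 1; apply: coefsP => k.
rewrite coefsD coefsB coefsN coefsMz mulr2n coefsD /delta0.
rewrite /negpart /mulxV /negpart.
have [k1|k1] := ltP k (-1).
  rewrite !ifT; [|lia..]; rewrite (_ : (k == 0) = false); last by lia.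
  by rewrite mul0r; lia.
have [->|km1] := eqVneq k (-1).
  by rewrite /= (_ : -1 + 1 = 0 :> int) // f0 /=; lia.
have [->|k0] := eqVneq k 0.
  rewrite ltxx sub0r add0r (_ : -1 < 0 :> int) // (_ : (1 < 0 :> int) = false) //.
  by rewrite f1 mul1r; ring.
by rewrite !ifF; [rewrite mul0r; ring|lia..].
Qed.

Lemma wcoefs_antisymmetric w : antisymmetric_coefs (wcoefs w).
Proof.
elim: w => [|[] w IH]; first by rewrite wcoefs_nil; exact: mulxV_delta0_antisymmetric.
  by rewrite wcoefs_c; exact: antisymmetric_wcoefs_c.
rewrite wcoefs_d antisymmetric_wcoefs_d // => k.
by rewrite (raddfMz mulxV) /= !coefsMz mulxV_delta0_antisymmetric mulNr.
Qed.

Lemma wcoefs_dE w : wcoefs (Ld :: w) = wcoefs [::] *~ wcoefs w 1.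
Proof.
rewrite wcoefs_d antisymmetric_wcoefs_d ?wcoefs_nil ?raddfMz //.
exact: wcoefs_antisymmetric.
Qed.

(** The letter d leaves a multiple of the series of the empty word, and the operators of the
    preceding letters c are linear. *)
Lemma wcoefs_cat_d r w :
  wcoefs (nseq r Lc ++ Ld :: w) = wcoefs (nseq r Lc) *~ wcoefs w 1.
Proof.
elim: r => [|r IH] /=; first exact: wcoefs_dE.
by rewrite !wcoefs_c IH raddfMz -mulrz_nat -!mulrzA mulrC mulrzA -mulrzBl raddfMz.
Qed.

Definition ccoef (r j : nat) : int := wcoefs (nseq r Lc) j%:Z.

Lemma ccoef00 j : ccoef 0 j = (j == 1)%N%:R.
Proof. by rewrite /ccoef wcoefs_nil /mulxV /delta0; case: j => [|[|j]]. Qed.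

Lemma ccoef_0 r : ccoef r 0 = 0.
Proof. by rewrite /ccoef; apply/antisymmetric_coefs0/wcoefs_antisymmetric. Qed.

Lemma ccoefSS r j : ccoef r.+1 j.+1 = ccoef r j - ccoef r j.+2.
Proof.
rewrite /ccoef /= wcoefs_c /mulxV !sub_negpartE.
have -> : j.+1%:Z - 1 = j by lia.
by have -> : j.+1%:Z + 1 = j.+2 by lia.
Qed.

Lemma ccoef_eq0 r j : (r.+1 < j)%N || ~~ odd (r + j) -> ccoef r j = 0.
Proof.
elim: r j => [|r IH] [|j]; rewrite ?ccoef_0 // ?ccoef00.
  by case: j => [|[|j]].
by move=> h; rewrite ccoefSS !IH ?subr0 //; lia.
Qed.

(** The ballot number C(r,i) - C(r,i-1), with C(r,-1) = 0. *)
Definition ballot_int (r i : nat) : int :=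
  'C(r, i)%:Z - (if i is i'.+1 then 'C(r, i')%:Z else 0).

(** Up to the alternating sign, the recursion [ccoefSS] is Pascal's rule for differences of
    binomials. *)
Lemma ccoefE r j i : (j + i.*2)%N = r.+1 -> ccoef r j = (-1) ^+ i * ballot_int r i.
Proof.
elim: r j i => [|r IH] [|j] i e.
- lia.
- have [-> ->] : i = 0%N /\ j = 0%N by lia.
  by rewrite ccoef00.
(* On the boundary [j = 0] the two binomials agree by symmetry. *)
- rewrite ccoef_0; case: i e => [|i] e; first by lia.
  rewrite /ballot_int -(@bin_sub _ i.+1); last by lia.
  by rewrite (_ : r.+1 - i.+1 = i)%N ?subrr ?mulr0 //; lia.
rewrite ccoefSS (IH j i); last by lia.
case: i e => [|i] e.
  by rewrite ccoef_eq0 ?subr0 /ballot_int ?bin0 //; lia.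
rewrite (IH j.+2 i); last by lia.
rewrite exprS mulN1r !mulNr -opprD -mulrDr; congr (- (_ * _)).
rewrite /ballot_int binS; case: i {e} => [|i]; rewrite ?binS ?bin0; lia.
Qed.

(** * Ballot and Catalan numbers *)

(** Multiply by r+1 and use (r+1) C(r,i) = (r+1-i) C(r+1,i) and (r+1) C(r,i-1) = i C(r+1,i). *)
Lemma ballot_intE r i : (i.*2 <= r.+1)%N ->
  (r.+1 - i.*2)%:R / r.+1%:R * ('C(r.+1, i))%:R = (ballot_int r i)%:~R :> rat.
Proof.
move=> ir; have r0 : r.+1%:R != 0 :> rat by rewrite pnatr_eq0.
rewrite mulrAC; apply: (canLR (mulfK r0)); rewrite [RHS]mulrC.
have e1 : (r.+1 * 'C(r, i) = (r.+1 - i) * 'C(r.+1, i))%N by rewrite -mul_bin_down.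
have e2 : ((if i is i'.+1 then 'C(r, i') else 0) * r.+1 = i * 'C(r.+1, i))%N.
  by case: i {ir e1} => // i; rewrite mulnC -mul_bin_diag.
rewrite /ballot_int rmorphB /= mulrBr.
have -> : (if i is i'.+1 then 'C(r, i')%:Z else 0) =
    (if i is i'.+1 then 'C(r, i') else 0)%N%:Z by case: (i).
rewrite -!pmulrn -!natrM e1 mulnC [X in _ - X%:R]mulnC e2.
rewrite -natrB; last by rewrite leq_mul2r; apply/orP; right; lia.
by rewrite -mulnBl -subnDA addnn mulnC.
Qed.

(** For odd [n] parity gives 0. For [n = 2i] the coefficient at x is the middle ballot number, which
    is the Catalan number C_i. *)
Lemma ccoef1E n :
  (ccoef n 1)%:~R = (-1) ^+ n./2 * catalan_half n :> rat.
Proof.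
rewrite /catalan_half; case: ifPn => no.
  by rewrite ccoef_eq0 ?mulr0 // addn1 /= no.
have nE : n = n./2.*2 by rewrite -[LHS]odd_double_half (negbTE no).
rewrite (@ccoefE _ _ n./2); last by lia.
rewrite rmorphM rmorphXn rmorphN1 /= -ballot_intE /catalan; last by lia.
by rewrite -nE subSnn mul1r [X in _ * X]mulrC.
Qed.

(** * Words cut at their first d *)

Lemma wordP (w : cdword) :
  w = nseq (size w) Lc \/ exists r w', w = nseq r Lc ++ Ld :: w'.
Proof.
elim: w => [|[] w [->|[r [w' ->]]]]; [by left|by left; rewrite /= size_nseq| | |].
- by right; exists r.+1, w'.
- by right; exists 0%N, (nseq (size w) Lc).
by right; exists 0%N, (nseq r Lc ++ Ld :: w').
Qed.

Lemma cexponents_nseq r : cexponents (nseq r Lc) = [:: r].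
Proof. by elim: r => //= r ->. Qed.

Lemma cexponents_cat r w : cexponents (nseq r Lc ++ Ld :: w) = r :: cexponents w.
Proof. by elim: r => //= r ->. Qed.

Lemma wdeg_cat w1 w2 : wdeg (w1 ++ w2) = (wdeg w1 + wdeg w2)%N.
Proof. by rewrite /wdeg map_cat sumn_cat. Qed.

Lemma wdeg_nseq r : wdeg (nseq r Lc) = r.
Proof. by elim: r => //= r IH; rewrite /wdeg /= -/(wdeg _) IH. Qed.

Lemma wnum_d_cat w1 w2 : wnum_d (w1 ++ w2) = (wnum_d w1 + wnum_d w2)%N.
Proof. exact: count_cat. Qed.

Lemma wnum_d_nseq r : wnum_d (nseq r Lc) = 0%N.
Proof. by rewrite /wnum_d count_nseq mul0n. Qed.

Lemma even_wdeg w : even_word (Ld :: w) -> ~~ odd (wdeg w).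
Proof.
rewrite /even_word /=; move: {2}(size w) (leqnn (size w)) => k.
elim: k w => [|k IH] w; first by case: w.
case: (wordP w) => [->|[r [w' ->]]].
  by rewrite cexponents_nseq wdeg_nseq /= andbT.
rewrite size_cat size_nseq /= addnS ltnS => sz; rewrite cexponents_cat /=.
move=> /andP [r0 /IH]; rewrite wdeg_cat wdeg_nseq /wdeg /= -/(wdeg _) !oddD /=.
by rewrite (negbTE r0) => ->//; rewrite (leq_trans _ sz) ?leq_addl.
Qed.

(** Each initial piece c^r d splits off the factor [ccoef r 1], a signed Catalan number that is 0
    for odd [r]; this is where evenness of the word comes from. *)
Lemma wcoefs1E w : (wcoefs w 1)%:~R =
  (if even_word (Ld :: w) then
    (-1) ^+ ((wdeg w)./2 + wnum_d w) * Cword (Ld :: w) else 0) :> rat.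
Proof.
rewrite /Cword [behead _]/=; move: {2}(size w) (leqnn (size w)) => k.
elim: k w => [|k IH] w.
  case: w => // _; rewrite /= big_seq1 -[wcoefs _ _]/(ccoef 0 1) ccoef1E.
  by rewrite expr0.
case: (wordP w) => [->|[r [w' ->]]].
  move: (size w) => r _; rewrite /even_word /= cexponents_nseq /= andbT.
  rewrite big_seq1 wdeg_nseq wnum_d_nseq addn0 -[wcoefs _ _]/(ccoef r 1) ccoef1E.
  by case: ifPn => // /negbNE ro; rewrite /catalan_half ro mulr0.
rewrite size_cat size_nseq /= addnS ltnS => sz.
have {}sz : (size w' <= k)%N by rewrite (leq_trans _ sz) ?leq_addl.
rewrite wcoefs_cat_d coefsMz rmorphM /= (IH w') //.
rewrite -[wcoefs (nseq r Lc) 1]/(ccoef r 1) ccoef1E.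
rewrite /even_word /= cexponents_cat /= big_cons.
case: (boolP (odd r)) => ro /=; first by rewrite /catalan_half ro mulr0 mul0r.
case: ifPn => ev; last by rewrite mulr0.
have := @even_wdeg w'; rewrite /even_word /= => /(_ ev) ew.
rewrite wdeg_cat wdeg_nseq wnum_d_cat wnum_d_nseq /wdeg /= -/(wdeg _).
rewrite /wnum_d /= -/(wnum_d _).
(* The letter d adds 1 to the half degree and 1 to the number of d's, hence no sign. Halving is
   additive because [r] and [wdeg w'] are even. *)
rewrite (_ : (r + (2 + wdeg w'))./2 + (0 + (1 + wnum_d w')) =
  2 + (r./2 + ((wdeg w')./2 + wnum_d w')))%N; last by lia.
by rewrite !exprD expr2 mulrNN mul1r; ring.
Qed.

Definition lead_c (w : cdword) : nat := find (pred1 Ld) w.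

Lemma lead_c_nseq r : lead_c (nseq r Lc) = r.
Proof. by rewrite /lead_c; elim: r => //= r ->. Qed.

Lemma lead_c_cat r w : lead_c (nseq r Lc ++ Ld :: w) = r.
Proof. by rewrite /lead_c; elim: r => //= r ->. Qed.

(** * Grouping words by their initial run of c's *)

Section TailSum.
Variables (psi : {fsfun cdword -> int with 0}).

(** [lead_c w == r] leaves c^r itself or c^r d w'; the condition [r < size w] selects the latter,
    and dropping [r.+1] letters gives w'. *)
Definition tails (r : nat) : seq cdword :=
  [seq drop r.+1 w | w <- [seq w <- finsupp psi | (lead_c w == r) && (r < size w)%N]].

Lemma tails_filter r (w : cdword) :
  (lead_c w == r) && (r < size w)%N -> w = nseq r Lc ++ Ld :: drop r.+1 w.
Proof.
case: (wordP w) => [{1 2 3}->|[r' [w' ->]]].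
  by rewrite lead_c_nseq => /andP [/eqP <-]; rewrite size_nseq ltnn.
rewrite lead_c_cat => /andP [/eqP <-] _; congr (_ ++ _ :: _).
by rewrite -cat_rcons drop_size_cat // size_rcons size_nseq.
Qed.

Lemma uniq_tails r : uniq (tails r).
Proof.
rewrite map_inj_in_uniq ?filter_uniq ?fset_uniq // => w1 w2; rewrite !mem_filter.
by move=> /andP [/tails_filter e1 _] /andP [/tails_filter e2 _] e; rewrite e1 e2 e.
Qed.

Lemma mem_tails r w : (w \in tails r) = (nseq r Lc ++ Ld :: w \in finsupp psi).
Proof.
apply/mapP/idP => [[x]|wp].
  by rewrite mem_filter => /andP [/tails_filter e xp] ->; rewrite -e.
exists (nseq r Lc ++ Ld :: w).
  by rewrite mem_filter wp lead_c_cat eqxx size_cat size_nseq /= addnS ltnS leq_addr.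
by rewrite -cat_rcons drop_size_cat // size_rcons size_nseq.
Qed.

(** The weights of [acoef] are the values [wcoefs w 1], which vanish on words that are not even, so
    the sum may run over all tails in the support. *)
Lemma acoefE r : acoef psi r = (psi (nseq r Lc))%:~R +
  \sum_(w <- tails r) (wcoefs w 1)%:~R * (psi (nseq r Lc ++ Ld :: w))%:~R.
Proof.
rewrite /acoef; congr (_ + _).
rewrite (fsbigE [seq w <- tails r | even_word (Ld :: w)]).
- rewrite big_filter_cond big_mkcond; apply: eq_bigr => w _.
  rewrite wcoefs1E.
  have -> : (w \in [set w | even_word (Ld :: w)]) = even_word (Ld :: w).
    by apply/idP/idP => [/set_mem|/mem_set].
  by rewrite andbb; case: ifP => // _; rewrite mul0r.
- by rewrite filter_uniq // uniq_tails.
- by move=> w /=; rewrite mem_filter => /andP [].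
move=> w /= ew; rewrite mem_filter ew mem_tails /= => /fsfun_dflt ->.
by rewrite mulr0.
Qed.

Lemma psi_wcoefs_sum (B j : nat) :
  (forall w, w \in finsupp psi -> (size w < B)%N) ->
  \sum_(w <- finsupp psi) (psi w * wcoefs w j%:Z)%:~R =
  \sum_(r < B) acoef psi r * (ccoef r j)%:~R :> rat.
Proof.
move=> hB; pose F w : rat := (psi w * wcoefs w j%:Z)%:~R.
transitivity (\sum_(r < B) \sum_(w <- finsupp psi | lead_c w == r) F w).
  under [RHS]eq_bigr do rewrite big_mkcond.
  rewrite exchange_big big_seq [RHS]big_seq; apply: eq_bigr => w /hB wB.
  have lw : (lead_c w < B)%N by exact: leq_ltn_trans (find_size _ _) wB.
  rewrite (bigD1 (Ordinal lw)) //= eqxx big1 ?addr0 // => r ne.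
  by case: eqP => // e; case/eqP: ne; apply: val_inj; rewrite /= e.
apply: eq_bigr => [[r /= _] _]; rewrite acoefE mulrDl (bigID (fun w => r < size w)%N).
rewrite [LHS]addrC /=; congr (_ + _).
  rewrite (eq_bigl (pred1 (nseq r Lc))) => [|w /=]; last first.
    apply/andP/eqP => [[/eqP <-]|->]; last by rewrite lead_c_nseq size_nseq ltnn eqxx.
    case: (wordP w) => [->|[r' [w' ->]]]; first by rewrite lead_c_nseq.
    by rewrite lead_c_cat size_cat size_nseq /= addnS ltnS leq_addr.
  rewrite -big_filter; have [inp|nin] := boolP (nseq r Lc \in finsupp psi).
    by rewrite filter_pred1_uniq ?fset_uniq // big_seq1 /F rmorphM.
  rewrite (fsfun_dflt nin) mul0r big_filter big_seq_cond big1 // => w.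
  by move=> /andP [wp /eqP e]; rewrite -e wp in nin.
rewrite big_map big_filter mulr_suml; apply: eq_bigr => w /tails_filter e.
by rewrite /F {2}e wcoefs_cat_d coefsMz -e !rmorphM /= -/(ccoef r j); ring.
Qed.
End TailSum.

Lemma size_le_wdeg w : (size w <= wdeg w)%N.
Proof. by elim: w => // x w IH; rewrite /wdeg /= -/(wdeg w); case: x => /=; lia. Qed.

(** * Triangularity and comparison of coefficients *)

Section Assembly.
Variables (W : groupType) (S : set W) (H : algType laurent) (T : W -> H).
Variables (R Rt P : W -> W -> {poly int}) (u v : W).
Variable (psi : {fsfun cdword -> int with 0}).
Hypothesis coxS : coxeter_system S.
Hypothesis hR : R_polynomials S T R.
Hypothesis hRt : Rtilde_polynomials S R Rt.
Hypothesis hP : KL_polynomials S R P.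
Hypothesis huv : bruhat_lt S u v.
Hypothesis hpsi : complete_cd_index S Rt u v psi.

(** The sign of the outermost [- negpart] is absorbed by antisymmetry, which moves the coefficient
    from x^-j to x^j. *)
Lemma KL_coefs_wcoefs (j : nat) : (0 < j)%N ->
  KL_coefs S P u v (- j%:Z) = \sum_(w <- finsupp psi) psi w * wcoefs w j%:Z.
Proof.
move=> j0; pose B := maxn (len2 S u v) (\max_(w <- finsupp psi) wdeg w).+1.
have wB w : w \in finsupp psi -> (wdeg w < B)%N.
  by move=> wp; rewrite /B leq_max ltnS leq_bigmax_seq ?orbT.
rewrite (KL_coefs_bits coxS hR hRt hP huv (leq_maxl _ _ : _ <= B)%N).
transitivity ((- negpart (\sum_(w <- finsupp psi) wcoefs w *~ psi w)) (- j%:Z)).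
  congr ((- negpart _) _).
  transitivity (\sum_(w <- finsupp psi) \sum_(m < B) \sum_(b <- bits m)
      bits_coefs b *~ Theta w (exponent (comp_of_bits 1 b)) *~ psi w).
    rewrite [RHS]exchange_big; apply: eq_bigr => m _.
    rewrite [RHS]exchange_big; apply: eq_bigr => b _.
    rewrite hpsi mulrz_sumr; apply: eq_bigr => w _.
    by rewrite mulrC mulrzA.
  rewrite big_seq [RHS]big_seq; apply: eq_bigr => w /wB lw.
  rewrite -(wcoefs_sum lw) mulrz_suml; apply: eq_bigr => m _.
  by rewrite mulrz_suml.
rewrite coefsN /negpart ifT; last by lia.
rewrite coefs_sum -sumrN; apply: eq_bigr => w _.
by rewrite coefsMz wcoefs_antisymmetric mulNr opprK mulrC.
Qed.

Lemma KL_coefs_eq0 (j : nat) : (len2 S u v < j)%N -> KL_coefs S P u v (- j%:Z) = 0.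
Proof. by move=> lj; rewrite /KL_coefs /laur ifF //; lia. Qed.

Lemma KL_coefs_acoef (B : nat) : (forall w, w \in finsupp psi -> (size w < B)%N) ->
  forall j, (0 < j)%N -> (KL_coefs S P u v (- j%:Z))%:~R =
    \sum_(r < B) acoef psi r * (ccoef r j)%:~R :> rat.
Proof.
by move=> hB j j0; rewrite KL_coefs_wcoefs // rmorph_sum -psi_wcoefs_sum.
Qed.

Lemma ccoef_top r : ccoef r r.+1 = 1.
Proof. by rewrite (@ccoefE _ _ 0) ?addn0 // /ballot_int bin0 mul1r subr0. Qed.

(** Descending induction on [r]. At x^-(r+1), beyond the range of [KL_coefs S P u v], smaller
    indices drop out by degree and larger ones by induction, while [acoef psi r] has coefficient
    1. *)
Lemma acoef_eq0 (B : nat) : (forall w, w \in finsupp psi -> (size w < B)%N) ->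
  forall r, (r < B)%N -> (len2 S u v <= r)%N -> acoef psi r = 0.
Proof.
move=> hB r; move: {2}(B - r)%N (leqnn (B - r)) => k.
elim: k r => [|k IH] r; first by lia.
move=> kr rB lr; have := KL_coefs_acoef hB (ltn0Sn r).
rewrite KL_coefs_eq0 // (bigD1 (Ordinal rB)) //= ccoef_top mulr1 big1 ?addr0 //.
move=> i ne; have ir : nat_of_ord i <> r by move=> e; case/eqP: ne; apply: val_inj.
have [le|ri] := leqP i r; first by rewrite ccoef_eq0 ?mulr0 //; lia.
by rewrite IH ?mul0r //; lia.
Qed.

Lemma sum_parity (n : nat) (G : nat -> rat) :
  (forall r, (r <= n)%N -> odd (n - r) -> G r = 0) ->
  \sum_(r < n.+1) G r = \sum_(i < n./2.+1) G (n - i.*2)%N.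
Proof.
elim/ltn_ind: n => [[|[|n]]] IH G0.
- by rewrite !big_ord1.
- by rewrite big_ord_recl big_ord1 /= G0 // add0r big_ord1.
rewrite big_ord_recr /= big_ord_recr /=.
rewrite (G0 n.+1) ?addr0 //; last by rewrite subSnn.
rewrite [RHS]big_ord_recl addrC subn0; congr (_ + _).
by rewrite IH // => r rn od; rewrite G0 //; lia.
Qed.

Lemma coef_comp_polyNX (p : {poly rat}) k : (p \Po - 'X)`_k = (-1) ^+ k * p`_k.
Proof.
rewrite comp_polyE coef_sum; under eq_bigr => i _.
  rewrite exprNn -[(-1) ^+ i]/((-1) ^+ i : {poly rat}) -polyC1 -polyCN -polyC_exp.
  rewrite coefZ coefCM coefXn; over.
have [kp|pk] := ltnP k (size p); last first.
  rewrite nth_default // mulr0 big1 // => i _.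
  by rewrite gtn_eqF ?mulr0 // (leq_trans (ltn_ord i)).
rewrite (bigD1 (Ordinal kp)) //= eqxx mulr1 mulrC big1 ?addr0 // => i ne.
rewrite (_ : (k == i) = false) ?mulr0 //; apply/eqP => e.
by case/eqP: ne; apply: val_inj.
Qed.

(** With l(u,v) = n+1, the power q^t of P corresponds to x^(2t-n-1) in [KL_coefs], hence the index
    [n.+1 - t.*2]. *)
Lemma coef_ballot_term (n i t : nat) : (i <= n./2)%N -> 
  ('X^i * (ballot (n - i.*2) \Po (- 'X)))`_t =
  if (t.*2 <= n)%N then (ccoef (n - i.*2) (n.+1 - t.*2))%:~R else 0.
Proof.
move=> hi; rewrite coefXnM; case: ltnP => ti.
  by case: ifP => // _; rewrite ccoef_eq0 //; lia.
rewrite coef_comp_polyNX /ballot coef_poly.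
have -> : (t - i < (n - i.*2)./2.+1)%N = (t.*2 <= n)%N by lia.
case: ifP => tn; last by rewrite mulr0.
rewrite (@ccoefE _ _ (t - i)); last by lia.
by rewrite rmorphM rmorphXn rmorphN1 /= -ballot_intE //; lia.
Qed.

Lemma map_KL_poly (n : nat) : n = (len2 S u v - 1)%N ->
  map_poly (intr : int -> rat) (P u v) =
  \sum_(i < n./2.+1)
    acoef psi (n - i.*2) *: ('X^i * (ballot (n - i.*2) \Po (- 'X))).
Proof.
move=> hn; have deg := KL_deg hP huv.
have ln : len2 S u v = n.+1 by rewrite hn; lia.
pose B := (n.+1 + \max_(w <- finsupp psi) wdeg w).+1.
have hB w : w \in finsupp psi -> (size w < B)%N.
  move=> wp; rewrite ltnS (leq_trans (size_le_wdeg w)) //.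
  by rewrite (leq_trans _ (leq_addl _ _)) // leq_bigmax_seq.
apply/polyP => t; rewrite coef_map coef_sum.
under eq_bigr => i _ do rewrite coefZ coef_ballot_term ?leq_ord //.
case: leqP => tn; last first.
  rewrite big1 => [|i _]; last by rewrite mulr0.
  by rewrite nth_default //; move: deg; rewrite ln; move: (size _) => s; lia.
have -> : (P u v)`_t = KL_coefs S P u v (- (n.+1 - t.*2)%N%:Z).
  rewrite /KL_coefs /laur ifT; last by lia.
  rewrite (_ : absz _ = t * 2)%N; last by lia.
  by rewrite coef_comp_poly_Xn // dvdn_mull // mulnK.
rewrite /= (KL_coefs_acoef hB); last by lia.
(* Parity leaves only the indices [n - i.*2]; those above [n] are removed by [acoef_eq0]. *)
rewrite -(sum_parity (G := fun r => acoef psi r * (ccoef r (n.+1 - t.*2))%:~R)).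
  have nB : (n.+1 <= B)%N by rewrite /B; lia.
  rewrite (big_ord_widen _ (fun r => acoef psi r * (ccoef r (n.+1 - t.*2))%:~R) nB).
  rewrite [RHS]big_mkcond; apply: eq_bigr => r _; case: ltnP => // nr.
  by rewrite (acoef_eq0 hB) ?mul0r // ln.
by move=> r rn od; rewrite ccoef_eq0 ?mulr0 //; lia.
Qed.
End Assembly.

Theorem theorem4p1 (W : groupType) (S : set W) (H : algType laurent)
  (T : W -> H) (R Rt P : W -> W -> {poly int}) (u v : W)
  (psi : {fsfun cdword -> int with 0}) (n : nat)
  (hWS : coxeter_system S)
  (hH : hecke_algebra S T)
  (hR : R_polynomials S T R)
  (hRt : Rtilde_polynomials S R Rt)
  (hP : KL_polynomials S R P)
  (huv : bruhat_lt S u v)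
  (hpsi : complete_cd_index S Rt u v psi)
  (hn : n = (len2 S u v - 1)%N) :
  map_poly (intr : int -> rat) (P u v) =
  \sum_(i < n./2.+1)
    acoef psi (n - i.*2) *: ('X^i * (ballot (n - i.*2) \Po (- 'X))).
Proof. exact: (map_KL_poly hWS hR hRt hP huv hpsi hn). Qed.
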